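(* Let $n\ge 5$ be fixed and let $D\ge 1$ be an integer. Then, uniformly over $D$, $$M_n(H,D)\le D^{(3n+2)/(3n+3)}H^{n(3n+1)/(3n+3)+o(1)}.$$
   Context: For a positive integer $H$, $\mathcal{I}_n(H)$ denotes the set of polynomials $X^n+a_{n-1}X^{n-1}+\dots+a_1X+a_0\in\mathbb{Z}[X]$ with $|a_0|,\dots,|a_{n-1}|<H$ that are irreducible over $\mathbb{Q}$. For an irreducible monic $f\in\mathbb{Z}[X]$, $\Delta(f)$ denotes the discriminant of the number field $\mathbb{Q}(\alpha)$, where $\alpha$ is a root of $f$. For an integer $\Delta$, $N_n(H,\Delta)$ is the number of $f\in\mathcal{I}_n(H)$ with $\Delta(f)=\Delta$, and $$M_n(H,D)=\sum_{|\Delta|\le D}N_n(H,\Delta),$$ the sum being over integers $\Delta$. $o(1)$ denotes a quantity that tends to $0$ as $H\to\infty$ for fixed $n$, uniformly in $D$. *)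

(* Defs.v *)
From HB Require Import structures.
From mathcomp Require Import all_boot all_order all_algebra all_field.
From mathcomp Require Import finmap.
From mathcomp Require Import all_classical all_reals all_analysis.

Set Implicit Arguments.
Unset Strict Implicit.
Unset Printing Implicit Defensive.

Import Order.TTheory GRing.Theory Num.Theory.
Import numFieldNormedType.Exports.

Local Open Scope classical_set_scope.
Local Open Scope ring_scope.

Section NumberField.
Variable L : fieldExtType rat.

Definition field_trace (x : L) : rat :=
  \tr (passmx.mxof (vbasis {:L}) (vbasis {:L}) (amulr x)).

Definition integral_basis (w : (\dim {:L}).-tuple L) : Prop :=
  basis_of {:L} w /\
  forall x : L, integralOver (intr : int -> L) x <-> inIntSpan w x.

Definition basis_discr (w : (\dim {:L}).-tuple L) : rat :=
  \det (\matrix_(i, j) field_trace (tnth w i * tnth w j)).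

(* Every number field has an integral basis, and the discriminant of such a
   basis is an integer that does not depend on the basis; the default value 0
   of xget is therefore never used. *)
Definition field_discr : int :=
  xget 0 [set d : int | exists2 w, integral_basis w & basis_discr w = d%:~R].

End NumberField.

(* The field Q(alpha), for alpha an algebraic number: num_field_exists gives an
   extension of rat that embeds in algC and is generated by the preimage of
   alpha. *)
Definition adjoin_rat (alpha : algC) : fieldExtType rat :=
  projT1 (num_field_exists [:: alpha]).

Definition some_root (f : {poly int}) : algC :=
  xget 0 [set a : algC | root (map_poly intr f) a].

Definition Delta (f : {poly int}) : int := field_discr (adjoin_rat (some_root f)).

Definition I_ (n H : nat) : set {poly int} :=
  [set f | [/\ f \is monic, size f = n.+1,
               forall i : nat, (i < n)%N -> `|f`_i| < H%:Z
             & irreducible_poly (map_poly (intr : int -> rat) f)]].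

Definition N_ (n H : nat) (d : int) : nat :=
  #|` fset_set (I_ n H `&` [set f | Delta f = d])|.

Definition M_ (n H D : nat) : nat :=
  \sum_(d \in [set d : int | `|d| <= D%:Z]) N_ n H d.

(* Main.v *)
From HB Require Import structures.
Require Import Defs.
From mathcomp Require Import all_boot all_order all_fingroup all_algebra all_field.
From mathcomp Require Import finmap boolp classical_sets cardinality fsbigop.
From mathcomp Require Import ring lra zify.

Set Implicit Arguments.
Unset Strict Implicit.
Unset Printing Implicit Defensive.

Import Order.TTheory GRing.Theory Num.Theory.

Local Open Scope ring_scope.

Local Notation QtoC := (map_poly (ratr : rat -> algC)).
Local Notation ZtoC := (map_poly (intr : int -> algC)).
Local Notation ZtoQ := (map_poly (intr : int -> rat)).

(** Few number fields of degree n have a discriminant of absolute value at most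
    D, and each of them contains few roots of polynomials of height H; both
    facts come from the geometry of numbers.

    Let f be one of the polynomials to be counted, K the field generated by a
    root of f, and use on K the n real coordinates Re + Im of the conjugates.
    In these coordinates the integers of K form a lattice whose covolume is the
    square root of the absolute value of the discriminant.  Minkowski's theorem
    on linear forms ([minkowski_linear_forms]) gives an integer b <> 0 all of
    whose coordinates but one are at most 1/2, the remaining one being O(sqrt D).
    Since the norm of b is at least 1, the conjugate with the large coordinate
    differs from every other conjugate, hence b generates K.  At most two
    conjugates of b are large, so the coefficients of its characteristic
    polynomial g are O(D) ([exists_small_generator]), which leaves O(D^n)
    possible g.

    Fix g.  If h is the rational polynomial with h(b) a root of f, then f is the
    product of the X - h(r), for r ranging over the roots of g
    ([exists_generating_poly]).  If f' and h' come from the same g, and if for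
    all r the coordinates of h(r) and h'(r) have the same integral part, then
    the product of the h(r) - h'(r) is a rational algebraic integer of modulus
    less than 1; it vanishes and f = f' ([generated_eq]).  By Landau's bound on
    the Mahler measure of f, the integral parts c_r satisfy
    prod_r max(1, |c_r|) = O(H) ([cells_bound]), so that at most O(H^2) vectors
    (c_r) occur ([card_bounded_prod]).

    Therefore M_n(H,D) = O(D^n H^2), and M_n(H,D) = O(H^n) trivially.  When
    D^(3n+2) >= H^(2n) the second bound implies the theorem; in the opposite case
    the first one does, as soon as n >= 5 ([min_exponent_tradeoff]).  The implied
    constant C is absorbed by taking o(H) = ln C / ln H. *)

(** * Linear forms: small integer points *)

(** Gaussian elimination with column pivoting: dividing by the largest entry of a
    row is what keeps the entries of [M] bounded by 1.  A point at which the
    triangular forms [L] are small is then a point at which the forms [A] are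
    small, while the determinant becomes a product of diagonal entries. *)
Lemma trig_pivot_decomposition (F : realFieldType) n (A : 'M[F]_n) :
  exists L M : 'M[F]_n, [/\ A = L *m M, is_trig_mx L,
    forall i j, `|M i j| <= 1 & `|\det M| = 1].
Proof.
elim: n A => [|n IHn] A.
  exists 0, 1%:M; split => //; first by apply/matrixP => -[].
  - by apply/is_trig_mxP => -[].
  - by case.
  - by rewrite det1 normr1.
have [j0 _ j0max] : {j0 : 'I_n.+1 | true & forall j, `|A 0 j| <= `|A 0 j0|}.
  case: (@arg_maxP _ _ _ (ord0 : 'I_n.+1) xpredT (fun j => `|A 0 j|)) => // j0 _ H.
  by exists j0 => // j; exact: H.
pose B : 'M_(1 + n) := xcol 0 j0 A.
pose a := ulsubmx B; pose r := ursubmx B; pose c := dlsubmx B.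
pose l : 'rV_n := (B 0 0)^-1 *: r.
have BE : B = block_mx a r c (drsubmx B) by rewrite submxK.
have rle j : `|r 0 j| <= `|B 0 0|.
  rewrite !mxE tpermL lshift0.
  by case: tpermP => _; rewrite ?j0max.
have lle j : `|l 0 j| <= 1.
  rewrite mxE normrM normfV; have [->|B0] := eqVneq (B 0 0) 0.
    by rewrite normr0 invr0 mul0r.
  by rewrite ler_pdivrMl ?normr_gt0// mulr1.
(* If the pivot vanishes, so does the whole first row, and [l = 0]. *)
have rE : r = a *m l.
  apply/rowP => j; rewrite [RHS]mxE big_ord1 [l 0 j]mxE.
  have -> : a 0 0 = B 0 0 by rewrite /a /ulsubmx mxE lshift0 mxE lshift0.
  have [B0|B0] := eqVneq (B 0 0) 0; last by rewrite mulrA divff ?mul1r.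
  by have := rle j; rewrite B0 normr0 normr_le0 => /eqP ->; rewrite !mul0r.
have [L1 [M1 [SE L1t M1le M1det]]] := IHn (drsubmx B - c *m l).
pose L : 'M_(1 + n) := block_mx a 0 c L1.
pose M : 'M_(1 + n) := block_mx 1%:M l 0 M1.
have LM : L *m M = B.
  rewrite mulmx_block !mulmx1 !mulmx0 !mul0mx !addr0 -SE -rE [RHS]BE.
  by congr block_mx; rewrite addrC subrK.
have Lt : is_trig_mx L.
  rewrite is_trig_block_mx// eqxx /= L1t andbT.
  by apply/is_trig_mxP => i j; rewrite !ord1.
exists L, (xcol 0 j0 M); split.
- rewrite xcolE mulmxA LM /B xcolE -mulmxA.
  by rewrite -perm_mxM tperm2 perm_mx1 mulmx1.
- exact: Lt.
- have Mle i j : `|M i j| <= 1.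
    rewrite /M; case: (split_ordP i) => i' ->; case: (split_ordP j) => j' ->.
    + by rewrite block_mxEul mxE; case: eqP => _; rewrite ?normr1 ?normr0.
    + by rewrite block_mxEur ord1.
    + by rewrite block_mxEdl mxE normr0.
    + by rewrite block_mxEdr.
  by move=> i j; rewrite mxE.
- rewrite xcolE det_mulmx det_perm normrM normr_sign mulr1.
  by rewrite (det_ublock 1%:M l M1) det1 mul1r.
Qed.

(** The half-open box with sides [L j j] is a fundamental domain of the lattice
    spanned by the rows of [L]: since [L] is triangular, the integers [x 0 j] can
    be chosen one after the other, starting from the last one. *)
Lemma trig_round (R : archiRealFieldType) n (L : 'M[R]_n) :
    is_trig_mx L -> (forall i, L i i != 0) ->
  forall k : 'rV[int]_n, exists x : 'rV[int]_n,
    forall j, let t := (map_mx intr x *m L) 0 j / L j j in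
      (k 0 j)%:~R <= t < (k 0 j)%:~R + 1.
Proof.
elim: n L => [|n IHn] L; first by move=> _ _ k; exists 0 => -[].
rewrite -[n.+1]/(1 + n)%N in L *; rewrite -[L]submxK.
set a := ulsubmx L; set r := ursubmx L; set c := dlsubmx L; set L1 := drsubmx L.
rewrite is_trig_block_mx// => /and3P[/eqP r0 _ L1t] diag0 k.
have [j|x' x'P] := IHn L1 L1t _ (rsubmx k).
  by have := diag0 (rshift 1 j); rewrite block_mxEdr.
have a0 : a 0 0 != 0 by have := diag0 (lshift n 0); rewrite block_mxEul.
pose t := (map_mx intr x' *m c) 0 0 / a 0 0.
pose x0 := k 0 (lshift n 0) + Num.ceil (- t).
exists (row_mx x0%:M x') => j /=.
rewrite map_row_mx r0 mul_row_block mulmx0 add0r.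
case: (split_ordP j) => j' ->; last first.
  by rewrite row_mxEr block_mxEdr; have := x'P j'; rewrite !mxE.
rewrite row_mxEl block_mxEul ord1 mxE.
have -> : (map_mx intr x0%:M *m a) 0 0 = x0%:~R * a 0 0.
  by rewrite mxE big_ord1 !mxE eqxx mulr1n.
rewrite mulrDl mulfK// -/t /x0 rmorphD /=.
have := Num.Theory.ceil_itv (- t).
set u := (Num.ceil (- t)); rewrite rmorphD rmorphN /=.
set v := u%:~R; set w := _%:~R => H.
by apply/andP; split; lra.
Qed.

(** Pigeonhole: in a cube of side [T], [trig_round] provides about
    [T ^ n / \prod_i `|L i i|] lattice points, which is more than the [T ^ n] unit
    cells of the cube.  The factor [2 ^+ n] pays for the rounding of each
    [T / `|L i i|] to an integer, at least half of it because
    [T >= 2 * `|L i i|]. *)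
Lemma trig_minkowski (R : archiRealFieldType) n (L : 'M[R]_n) :
    is_trig_mx L -> (forall i, L i i != 0) -> 2 ^+ n * \prod_i `|L i i| < 1 ->
  exists2 x : 'rV[int]_n, x != 0 & forall j, `|(map_mx intr x *m L) 0 j| < 1.
Proof.
move=> Lt diag0 Lsmall.
have Lgt0 i : 0 < `|L i i| by rewrite normr_gt0.
pose T' := (\sum_i (Num.truncn (2 * `|L i i|)).+1)%N.
pose T := T'.+1.
have TL i : 2 * `|L i i| <= T%:R.
  have L2 : 0 <= 2 * `|L i i| by rewrite mulr_ge0 ?ler0n.
  have /andP[_ /ltW H] := Num.Theory.truncn_itv L2.
  by apply: (le_trans H); rewrite ler_nat /T leqW// /T' (bigD1 i)//= leq_addr.
pose m i := Num.truncn (T%:R / `|L i i|).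
pose K := (\max_i m i)%N.
have TL0 i : 0 <= T%:R / `|L i i| by rewrite divr_ge0 ?ler0n// ltW.
have mle i : (m i)%:R <= T%:R / `|L i i|.
  by have /andP[] := Num.Theory.truncn_itv (TL0 i).
have mge i : T%:R / `|L i i| <= 2 * (m i)%:R.
  have /andP[_] := Num.Theory.truncn_itv (TL0 i).
  rewrite -/(m i) -natr1.
  have : 2 <= T%:R / `|L i i| by rewrite ler_pdivlMr.
  set t := _ / _ => t2 tm.
  have : (0 < (m i)%:R :> R) by lra.
  by rewrite ltr0n -(ler_nat R) => mi1; lra.
have [x_ x_P] : exists x_ : {ffun 'I_n -> 'I_K.+1} -> 'rV[int]_n, forall k i,
    let t := (map_mx intr (x_ k) *m L) 0 i / L i i in
    (k i : nat)%:R <= t < (k i).+1%:R.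
  apply: (fin_all_exists (P := fun (k : {ffun 'I_n -> 'I_K.+1}) x => forall i,
    let t := (map_mx intr x *m L) 0 i / L i i in
    (k i : nat)%:R <= t < (k i).+1%:R)) => k.
  have [x xP] := trig_round Lt diag0 (\row_i (k i : nat)%:Z).
  by exists x => i; have := xP i; rewrite mxE -natr1.
(* [z k i] has the sign of [L i i], so that two points can be compared through
   the absolute values of their coordinates. *)
pose z k i := (map_mx intr (x_ k) *m L) 0 i.
have zE k i : `|z k i| = (z k i / L i i) * `|L i i|.
  have /andP[t0 _] := x_P k i.
  rewrite -[LHS](divfK (lt0r_neq0 (Lgt0 i))) -normf_div ger0_norm//.
  by apply: le_trans t0; rewrite ler0n.
pose S := [pred k : {ffun 'I_n -> 'I_K.+1} | [forall i, (k i < m i)%N]].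
have zT k i : k \in S -> `|z k i| < T%:R.
  move=> /forallP/(_ i) kim; rewrite zE.
  have /andP[_ tlt] := x_P k i.
  rewrite -ltr_pdivlMr//; apply: lt_le_trans tlt _.
  by apply: le_trans (mle i); rewrite ler_nat.
have card_S : #|S| = (\prod_i m i)%N.
  have -> : #|S| = #|family (fun i => [pred k : 'I_K.+1 | (k < m i)%N])|.
    apply: eq_card => k; rewrite [LHS]inE.
    by apply/forallP/familyP => H i; have := H i; rewrite ?inE.
  rewrite card_family bigop.foldrE big_image /=; apply: eq_bigr => i _.
  have miK : (m i <= K.+1)%N by rewrite leqW// /K (bigD1 i)//= leq_maxl.
  by rewrite -sum1_card (big_ord_narrow miK) sum1_card card_ord.
pose c k : {ffun 'I_n -> 'I_T} := [ffun i => inord (Num.truncn `|z k i|)].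
have ltCS : (#|{ffun 'I_n -> 'I_T}| < #|S|)%N.
  rewrite card_S card_ffun !card_ord -(ltr_nat R) natrX rmorph_prod /=.
  rewrite -(ltr_pM2l (_ : 0 < 2 ^+ n :> R)) ?exprn_gt0//.
  apply: (@lt_le_trans _ _ (\prod_i (T%:R / `|L i i|))); last first.
    have -> : 2 ^+ n = \prod_(i < n) 2 :> R by rewrite prodr_const card_ord.
    by rewrite -big_split /= ler_prod// => i _; rewrite TL0 mge.
  rewrite big_split /= prodr_const card_ord mulrC ltr_pM2l ?exprn_gt0 ?ltr0n//.
  by rewrite prodfV -(mul1r _^-1) ltr_pdivlMr// prodr_gt0.
have /dinjectivePn[k kS [k' /andP[kk' k'S] ckk']] : ~~ dinjectiveb c S.
  apply/negP => /dinjectiveP/card_in_image cinj.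
  by move: ltCS; rewrite -cinj ltnNge max_card.
exists (x_ k - x_ k').
  apply: contra kk'; rewrite subr_eq0 => /eqP xx'.
  apply/eqP/ffunP => i; apply/val_inj/eqP; rewrite eqn_leq /=.
  have /andP[t1 t2] := x_P k i; have /andP[] := x_P k' i; rewrite -xx'.
  move: t1 t2; set t := _ / _ => t1 t2 t3 t4.
  have := le_lt_trans t1 t4; have := le_lt_trans t3 t2.
  by rewrite !ltr_nat !ltnS => -> ->.
move=> j.
have -> : (map_mx intr (x_ k - x_ k') *m L) 0 j = z k j - z k' j.
  by rewrite map_mxB mulmxBl mxE [X in _ + X]mxE.
have zz' : `|z k j - z k' j| = `| `|z k j| - `|z k' j| |.
  rewrite !zE -mulrBl [RHS]normrM normr_id -normrM mulrBl !divfK//.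
have tr : Num.truncn `|z k j| = Num.truncn `|z k' j|.
  have := congr1 (fun f : {ffun 'I_n -> 'I_T} => nat_of_ord (f j)) ckk'.
  rewrite !ffunE !inordK//.
  - by rewrite -(ltr_nat R) (le_lt_trans _ (zT k' j k'S))// Num.Theory.truncn_le.
  - by rewrite -(ltr_nat R) (le_lt_trans _ (zT k j kS))// Num.Theory.truncn_le.
rewrite zz'.
have /andP[] := Num.Theory.truncn_itv (normr_ge0 (z k j)).
have /andP[] := Num.Theory.truncn_itv (normr_ge0 (z k' j)).
rewrite tr -natr1; set u := _%:R => *; rewrite ltr_norml; lra.
Qed.

(** The forms are rescaled so that all bounds become [n], which is the loss in
    going from the triangular factor back to [A]: each entry of the matrix [M] of
    [trig_pivot_decomposition] is at most 1. *)
Lemma minkowski_linear_forms (R : archiRealFieldType) n (A : 'M[R]_n)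
    (c : 'I_n -> R) : (0 < n)%N -> (forall j, 0 < c j) -> \det A != 0 ->
    (2 * n%:R) ^+ n * `|\det A| < \prod_j c j ->
  exists2 x : 'rV[int]_n, x != 0 &
    forall j, `|(map_mx intr x *m A) 0 j| < c j.
Proof.
case: n A c => // n A c _ c0 detA Asmall.
pose N : R := n.+1%:R; have N0 : 0 < N by rewrite ltr0n.
pose d : 'rV[R]_n.+1 := \row_j (N / c j).
have [L [M [AE Lt Mle Mdet]]] := trig_pivot_decomposition (A *m diag_mx d).
have dA : \prod_i `|L i i| = `|\det A| * (N ^+ n.+1 / \prod_j c j).
  rewrite -normr_prod -det_trig// -[LHS]mulr1 -[X in _ * X]Mdet -normrM.
  rewrite -det_mulmx -AE det_mulmx det_diag normrM; congr (_ * _).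
  rewrite ger0_norm; last by apply: prodr_ge0 => i _; rewrite mxE divr_ge0// ltW.
  under eq_bigr do rewrite mxE.
  by rewrite big_split /= prodr_const card_ord prodfV.
have c0' : 0 < \prod_j c j by apply: prodr_gt0.
have Lpos : 0 < \prod_i `|L i i|.
  by rewrite dA mulr_gt0 ?normr_gt0// divr_gt0// exprn_gt0.
have [i||x x0 xP] := trig_minkowski Lt.
- apply: contraTneq Lpos => L0; rewrite (bigD1 i)//= L0 normr0 mul0r ltxx//.
- by rewrite dA !mulrA ltr_pdivrMr// mul1r mulrAC -exprMn.
exists x => // j.
have : `|(map_mx intr x *m (A *m diag_mx d)) 0 j| < N.
  rewrite AE mulmxA mxE; apply: le_lt_trans (ler_norm_sum _ _ _) _.
  have -> : N = \sum_(i < n.+1) 1 by rewrite sumr_const card_ord.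
  apply: ltr_sum => [|i _]; first by apply/hasP; exists ord0; rewrite ?mem_index_enum.
  rewrite normrM; apply: le_lt_trans (xP i).
  by rewrite -[leRHS]mulr1 ler_wpM2l.
rewrite mulmxA mul_mx_diag !mxE normrM [ `|N / c j|]ger0_norm; last first.
  by rewrite divr_ge0// ltW.
by rewrite -ltr_pdivlMr ?divr_gt0// invf_div mulrC divfK// gt_eqF.
Qed.

(** * The embeddings of a number field *)

Section Embeddings.
Variable L : fieldExtType rat.
Local Notation m := (\dim {:L}).
Variables (sigma : 'I_m -> {rmorphism L -> algC}) (a : L).
Hypothesis sigma_a_inj : injective (fun i => sigma i a).

Definition emb_mx (w : m.-tuple L) : 'M[algC]_m :=
  \matrix_(i, j) sigma j (tnth w i).

Definition powers (x : L) : m.-tuple L := [tuple x ^+ i | i < m].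

Lemma det_emb_powers x :
  injective (fun i => sigma i x) -> \det (emb_mx (powers x)) != 0.
Proof.
move=> x_inj; have -> : emb_mx (powers x) = Vandermonde m (\row_j sigma j x).
  by apply/matrixP => i j; rewrite !mxE tnth_mktuple rmorphXn.
rewrite det_Vandermonde; apply/prodf_neq0 => i _; apply/prodf_neq0 => j ij.
rewrite !mxE subr_eq0; apply: contraTneq ij => /x_inj ->.
by rewrite ltnn.
Qed.

Lemma emb_mx_comb (w v : m.-tuple L) (C : 'M[rat]_m) :
    (forall i, tnth v i = \sum_k C i k *: tnth w k) ->
  emb_mx v = map_mx ratr C *m emb_mx w.
Proof.
move=> vE; apply/matrixP => i j; rewrite !mxE vE rmorph_sum /=.
by apply: eq_bigr => k _; rewrite rmorphZ_num !mxE.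
Qed.

(** The powers of [a] have an invertible matrix of conjugates, and they are rational
    combinations of any basis; conversely an invertible matrix of conjugates
    excludes a linear relation. *)
Lemma emb_basis (w : m.-tuple L) : basis_of {:L} w = (\det (emb_mx w) != 0).
Proof.
apply/idP/idP => [wb|dw].
  have := det_emb_powers sigma_a_inj.
  rewrite (@emb_mx_comb w _ (\matrix_(i, k) coord w k (tnth (powers a) i))).
    by rewrite det_mulmx mulf_eq0 => /norP[].
  move=> i; rewrite [LHS](coord_basis wb (memvf _)); apply: eq_bigr => k _.
  by rewrite mxE [tnth w k](tnth_nth 0).
rewrite basisEfree subvf size_tuple leqnn !andbT; apply/freeP => k k0 i.
have : map_mx ratr (\row_i k i) *m emb_mx w = 0.
  apply/rowP => j; rewrite !mxE -[RHS](rmorph0 (sigma j)) -k0 rmorph_sum /=.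
  by apply: eq_bigr => l _; rewrite rmorphZ_num !mxE (tnth_nth 0).
move/(congr1 (mulmx^~ (invmx (emb_mx w)))); rewrite mul0mx mulmxK ?unitmxE ?unitfE//.
by move/rowP/(_ i); rewrite !mxE => /eqP; rewrite fmorph_eq0 => /eqP.
Qed.

Lemma mulmx_emb (w : m.-tuple L) x : basis_of {:L} w ->
  map_mx ratr (passmx.mxof w w (amulr x)) *m emb_mx w =
  emb_mx w *m diag_mx (\row_j sigma j x).
Proof.
move=> wb; apply/matrixP => i j; rewrite mul_mx_diag !mxE -rmorphM.
have -> : tnth w i * x = \sum_k passmx.mxof w w (amulr x) i k *: tnth w k.
  have /(congr1 (passmx.vecof w)) := passmx.mul_mxof w w (amulr x) (delta_mx 0 i).
  rewrite passmx.rVofK// passmx.vecof_delta /= lfunE /= -rowE -(tnth_nth 0).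
  by move<-; apply: eq_bigr => k _; rewrite !mxE (tnth_nth 0).
rewrite rmorph_sum /=; apply: eq_bigr => k _.
by rewrite rmorphZ_num !mxE.
Qed.

(** The matrix of conjugates of a basis diagonalizes the multiplication by [x], so
    that trace, norm and characteristic polynomial of [x] are computed from its
    conjugates; in particular they are rational. *)
Lemma mulmx_emb_similar x :
  exists E M, [/\ E \in unitmx, \tr M = field_trace x &
    map_mx ratr M = E *m diag_mx (\row_j sigma j x) *m invmx E].
Proof.
have vb := vbasisP {:L}; have := vb; rewrite emb_basis -unitfE -unitmxE => vu.
exists (emb_mx (vbasis {:L})), (passmx.mxof (vbasis {:L}) (vbasis {:L}) (amulr x)).
by split => //; rewrite -mulmx_emb// mulmxK.
Qed.

Lemma ratr_trace x : ratr (field_trace x) = \sum_j sigma j x.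
Proof.
have [E [M [Eu <- ME]]] := mulmx_emb_similar x.
rewrite -trace_map_mx ME mxtrace_mulC mulKmx// mxtrace_diag.
by apply: eq_bigr => j _; rewrite mxE.
Qed.

Lemma prod_emb_rat x : \prod_j sigma j x \in Crat.
Proof.
have [E [M [Eu _ ME]]] := mulmx_emb_similar x.
apply/CratP; exists (\det M); rewrite -det_map_mx ME !det_mulmx det_inv mulrAC.
rewrite divff ?mul1r -?unitfE -?unitmxE// det_diag.
by apply: eq_bigr => j _; rewrite mxE.
Qed.

Lemma prod_XsubC_emb_rat x : exists q : {poly rat},
  map_poly ratr q = \prod_j ('X - (sigma j x)%:P).
Proof.
have [E [M [Eu _ ME]]] := mulmx_emb_similar x.
exists (char_poly M); rewrite map_char_poly ME.
have Eu' : map_mx polyC E \in unitmx by rewrite map_unitmx.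
have -> : \prod_j ('X - (sigma j x)%:P) = char_poly (diag_mx (\row_j sigma j x)).
  rewrite char_poly_trig ?diag_mx_is_trig//; apply: eq_bigr => j _.
  by rewrite !mxE eqxx mulr1n.
set D := diag_mx _; rewrite /char_poly.
have -> : char_poly_mx (E *m D *m invmx E) =
    map_mx polyC E *m char_poly_mx D *m invmx (map_mx polyC E).
  rewrite /char_poly_mx !map_mxM map_invmx mulmxBr mulmxBl.
  by rewrite -scalemx1 -scalemxAr -scalemxAl mulmx1 mulmxV.
rewrite !det_mulmx det_inv mulrAC divrr ?mul1r//.
Qed.

Lemma ratr_discr w : ratr (basis_discr w) = \det (emb_mx w) ^+ 2.
Proof.
rewrite /basis_discr -det_map_mx expr2 -[X in _ * X]det_tr -det_mulmx; congr (\det _).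
apply/matrixP => i j; rewrite mxE [in LHS]mxE /= ratr_trace [RHS]mxE; apply: eq_bigr => k _.
by rewrite !mxE rmorphM.
Qed.

Lemma Aint_emb j x : integralOver (intr : int -> L) x -> sigma j x \in Aint.
Proof.
case=> p p_monic /rootP px0; apply: (@root_monic_Aint (map_poly intr p)).
- apply/rootP; rewrite -(rmorph0 (sigma j)) -px0 -horner_map /=.
  by rewrite -map_poly_comp; congr _.[_]; apply: eq_map_poly => z /=; rewrite rmorph_int.
- exact: monic_map.
- by apply/polyOverP => i; rewrite coef_map /=.
Qed.

End Embeddings.

(** * Existence of an integral basis *)

Lemma det_replace_row (F : comNzRingType) n (j : 'I_n) (v : 'rV[F]_n) :
  \det (\matrix_(i, k) if i == j then v 0 k else (i == k)%:R) = v 0 j.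
Proof.
set C := \matrix_(i, k) _.
have cofC k : cofactor C j k = (k == j)%:R.
  transitivity ((\adj (1%:M : 'M[F]_n)) k j); last first.
    by rewrite -[\adj _]mul1mx mul_mx_adj det1 mxE.
  rewrite mxE /cofactor; congr (_ * \det _); apply/matrixP => i l.
  by rewrite !mxE eq_sym (negPf (neq_lift _ _)).
rewrite (expand_det_row _ j) (bigD1 j)//= cofC mxE !eqxx mulr1 big1 ?addr0//.
by move=> k kj; rewrite cofC (negPf kj) mulr0.
Qed.

Section IntegralBasis.
Variable L : fieldExtType rat.
Local Notation m := (\dim {:L}).
Variables (sigma : 'I_m -> {rmorphism L -> algC}) (a : L).
Hypothesis sigma_a_inj : injective (fun i => sigma i a).
Hypothesis a_int : integralOver (intr : int -> L) a.
Local Notation integral := (integralOver (intr : int -> L)).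

Lemma integral_comb (w : m.-tuple L) (c : 'I_m -> int) :
  (forall i, integral (tnth w i)) -> integral (\sum_i tnth w i *~ c i).
Proof.
move=> wi; elim/big_ind: _ => [|x y|i _]; [exact: integral0 | exact: integral_add|].
by rewrite -mulrzr; apply: integral_mul => //; apply: (integral_id (intr : {rmorphism int -> L})).
Qed.

Lemma discr_int (w : m.-tuple L) : (forall i, integral (tnth w i)) ->
  exists d : int, basis_discr w = d%:~R.
Proof.
move=> wi; have : (ratr (basis_discr w) : algC) \in Num.int.
  apply: Cint_rat_Aint; first exact: Crat_rat.
  rewrite (ratr_discr sigma_a_inj) rpredX// /determinant rpred_sum// => p _.
  rewrite rpredM ?rpredX ?rpredN ?rpred1// rpred_prod// => i _.
  by rewrite mxE Aint_emb.
case/intrP => d dE; exists d; apply: (fmorph_inj (ratr : {rmorphism rat -> algC})).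
by rewrite /= dE ratr_int.
Qed.

Lemma basis_discr_neq0 (w : m.-tuple L) : basis_of {:L} w -> basis_discr w != 0.
Proof.
rewrite (emb_basis sigma_a_inj) -(fmorph_eq0 (ratr : {rmorphism rat -> algC})) /=.
by rewrite (ratr_discr sigma_a_inj) expf_eq0.
Qed.

Lemma inIntSpan_tnth (w : m.-tuple L) x :
  inIntSpan w x <-> exists c : 'I_m -> int, x = \sum_i tnth w i *~ c i.
Proof.
split=> [[c ->]|[c ->]].
  by exists c; apply: eq_bigr => i _; rewrite (tnth_nth 0).
exists [ffun i => c i]; apply: eq_bigr => i _.
by rewrite ffunE (tnth_nth 0).
Qed.

(** Among the bases made of integral elements, one of minimal absolute discriminant is
    an integral basis: if an integral [x] had a non-integral coordinate on the
    [j]-th vector [tnth w j], replacing that vector by [x] minus an integral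
    multiple of it would multiply the discriminant by the square of a fractional
    part. *)
Lemma exists_integral_basis : exists w : m.-tuple L, integral_basis w.
Proof.
suff descent N : forall w : m.-tuple L, basis_of {:L} w ->
    (forall i, integral (tnth w i)) ->
    forall d : int, basis_discr w = d%:~R -> (`|d| <= N)%N ->
    exists w' : m.-tuple L, integral_basis w'.
  have pint i : integral (tnth (powers a) i).
    rewrite tnth_mktuple; elim: (i : nat) => [|k IHk]; first exact: integral1.
    by rewrite exprS; apply: integral_mul.
  have [d dE] := discr_int pint.
  apply: (descent `|d|%N _ _ pint d dE) => //.
  by rewrite (emb_basis sigma_a_inj) det_emb_powers.
elim: N => [|N IHN] w wb wi d dE dN.
  by have := basis_discr_neq0 wb; rewrite dE intr_eq0 -absz_eq0 -leqn0 dN.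
have [all_span|] := pselect (forall x, integral x -> inIntSpan w x).
  exists w; split=> // x; split; first exact: all_span.
  by move/inIntSpan_tnth => [c ->]; apply: integral_comb.
move/existsNP => [x /not_implyP[xi xNspan]].
have [j qjNint] : exists j, coord w j x \isn't a Num.int.
  apply: contrapT => /forallNP cint; apply: xNspan; apply/inIntSpan_tnth.
  exists (fun i => Num.floor (coord w i x)).
  rewrite [LHS](coord_basis wb (memvf x)); apply: eq_bigr => i _.
  by rewrite -(tnth_nth 0) -scaler_int floorK//; have /negP := cint i; rewrite negbK.
pose th : rat := coord w j x - (Num.floor (coord w j x))%:~R.
have /andP[th0 th1] : 0 < th < 1.
  have /andP[f1 f2] := floor_itv (coord w j x).
  move: f2; rewrite intrD => f2; rewrite /th subr_gt0 ltrBlDl f2 andbT lt_neqAle f1 andbT.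
  by apply: contra qjNint => /eqP <-; apply: rpred_int.
pose x' := x - tnth w j *~ Num.floor (coord w j x).
have x'i : integral x'.
  apply: integral_sub => //.
  rewrite -mulrzr; apply: integral_mul => //.
  exact: (integral_id (intr : {rmorphism int -> L})).
pose w' : m.-tuple L := [tuple if i == j then x' else tnth w i | i < m].
pose v : 'rV[rat]_m := \row_k coord w k x'.
have w'E i : tnth w' i = \sum_k (\matrix_(i, k) if i == j then v 0 k else (i == k)%:R) i k *: tnth w k.
  rewrite tnth_mktuple; have [->|ij] := eqVneq i j.
    rewrite [LHS](coord_basis wb (memvf x')); apply: eq_bigr => k _.
    by rewrite !mxE eqxx (tnth_nth 0).
  rewrite (bigD1 i)//= mxE (negPf ij) eqxx scale1r big1 ?addr0// => k ki.
  by rewrite mxE (negPf ij) eq_sym (negPf ki) scale0r.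
have vth : v 0 j = th.
  rewrite mxE linearB /= /th -scaler_int linearZ /= (tnth_nth 0).
  by rewrite coord_free ?(basis_free wb)// eqxx mulr1.
have embw' := emb_mx_comb sigma w'E.
have det' : \det (emb_mx sigma w') = ratr th * \det (emb_mx sigma w).
  by rewrite embw' det_mulmx det_map_mx det_replace_row vth.
have w'i i : integral (tnth w' i) by rewrite tnth_mktuple; case: ifP.
have [d' d'E] := discr_int w'i.
have discr' : basis_discr w' = th ^+ 2 * basis_discr w.
  apply: (fmorph_inj (ratr : {rmorphism rat -> algC})) => /=.
  by rewrite rmorphM rmorphXn /= !(ratr_discr sigma_a_inj) det' exprMn.
apply: (IHN w' _ w'i d' d'E).
  rewrite (emb_basis sigma_a_inj) det' mulf_neq0//.
    by rewrite fmorph_eq0 gt_eqF.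
  by rewrite -(emb_basis sigma_a_inj).
rewrite -ltnS; apply: leq_trans dN; rewrite -ltz_nat -(ltr_int rat) !intr_norm.
rewrite -d'E -dE discr' normrM gtr_pMl ?normr_gt0 ?basis_discr_neq0//.
by rewrite ger0_norm ?exprn_ge0 ?ltW// expr_lt1// ltW.
Qed.

Lemma integral_basis_integral (w : m.-tuple L) i :
  integral_basis w -> integral (tnth w i).
Proof.
case=> _ wP; apply/wP/inIntSpan_tnth; exists (fun k => (k == i)%:R).
by rewrite (bigD1 i)//= eqxx mulr1z big1 ?addr0// => k /negPf ->.
Qed.

End IntegralBasis.

(** * A small generator of the field *)

(** For a real embedding this is the value itself, and for a pair of conjugate
    complex embeddings it gives the two coordinates Re + Im and Re - Im.  This
    single formula treats both kinds of embeddings alike, and up to the factor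
    [sqrt 2] it is an isometry on each conjugate pair. *)
Definition ReIm (z : algC) : algC := 'Re z + 'Im z.

Lemma ReIm_real z : ReIm z \is Creal.
Proof. by rewrite rpredD ?Creal_Re ?Creal_Im. Qed.

Lemma ReIm_mulE (u v : algC) : ReIm u * ReIm v =
  - ('i / 2) * (u * v) + ('i / 2) * (u * v)^* + (u * v^* ) / 2 + (u * v^* )^* / 2.
Proof.
rewrite /ReIm !rmorphM /= conjCK.
have conjE z : z^* = 'Re z - 'i * 'Im z.
  by rewrite {1}[z]Crect conjC_rect ?Creal_Re ?Creal_Im.
have key (p q p' q' : algC) : (p + q) * (p' + q') =
    - ('i / 2) * ((p + 'i * q) * (p' + 'i * q')) +
    'i / 2 * ((p - 'i * q) * (p' - 'i * q')) +
    (p + 'i * q) * (p' - 'i * q') / 2 + (p - 'i * q) * (p' + 'i * q') / 2.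
  by have i2 := sqrCi algC; field: i2.
by rewrite key -!conjE -!Crect.
Qed.

Lemma coef_prod_XsubC_bound (R : numDomainType) (I : Type) (r : seq I) (F : I -> R) k :
  `|(\prod_(i <- r) ('X - (F i)%:P))`_k| <= \prod_(i <- r) (1 + `|F i|).
Proof.
elim: r k => [|i r IHr] k.
  by rewrite !big_nil coef1; case: eqP; rewrite ?normr1 ?normr0.
rewrite !big_cons mulrBl coefB coefXM coefCM mulrDl mul1r.
apply: le_trans (ler_normB _ _) _; apply: lerD.
  by case: eqP => // _; rewrite normr0 prodr_ge0// => j _; rewrite addr_ge0.
by rewrite normrM ler_wpM2l.
Qed.

Lemma deriv_prod_XsubC (R : comNzRingType) (I : finType) (F : I -> R) i :
  (\prod_j ('X - (F j)%:P))^`().[F i] = \prod_(j | j != i) (F i - F j).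
Proof.
rewrite (bigD1 i)//= derivM derivXsubC mul1r !hornerE subrr mul0r addr0.
by rewrite horner_prod; apply: eq_bigr => j _; rewrite !hornerE.
Qed.

(** The factor [(4 * m) ^ (2 * m)] is the square of the constant lost in Minkowski's
    theorem, and [2 ^ m] bounds the number of terms of an elementary symmetric
    function. *)
Definition generator_height (m : nat) := (2 ^ m * (4 * m) ^ (2 * m))%N.

Section SmallGenerator.
Variable L : fieldExtType rat.
Local Notation m := (\dim {:L}).
Variables (sigma : 'I_m -> {rmorphism L -> algC}) (a : L) (s : 'I_m -> 'I_m).
Hypothesis sigma_a_inj : injective (fun i => sigma i a).
Hypothesis sigma_conj : forall i x, sigma (s i) x = (sigma i x)^*.
Local Notation integral := (integralOver (intr : int -> L)).

Lemma conj_index_bij : bijective s.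
Proof.
exists s => i; apply: sigma_a_inj; rewrite !sigma_conj conjCK//.
Qed.

(** Complex conjugation permutes the embeddings. *)
Lemma sum_conj (F : 'I_m -> algC) :
  (forall i, F (s i) = (F i)^*) -> \sum_i (F i)^* = \sum_i F i.
Proof.
move=> Fs; rewrite [RHS](reindex s) /=; last exact/onW_bij/conj_index_bij.
by apply: eq_bigr => i _; rewrite Fs.
Qed.

Definition coordR i (x : L) : algR := in_algR (ReIm_real (sigma i x)).
Definition normR i (x : L) : algR := in_algR (normr_real (sigma i x)).

Lemma normR_ge0 i x : 0 <= normR i x.
Proof. exact: (normr_ge0 (sigma i x)). Qed.

Lemma normR_conj i x : normR (s i) x = normR i x.
Proof. by apply: val_inj; rewrite /= sigma_conj norm_conjC. Qed.

Lemma coord_normR i x :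
  coordR i x ^+ 2 + coordR (s i) x ^+ 2 = 2 * normR i x ^+ 2.
Proof.
apply: val_inj; rewrite -/algRval rmorphM rmorphD !rmorphXn /=.
rewrite /ReIm sigma_conj Re_conj Im_conj normC2_Re_Im; ring.
Qed.

(** The passage from the conjugates to the real coordinates is unitary: in
    [ReIm_mulE] the first two terms cancel after summation over all embeddings, and
    the last two have equal sums. *)
Lemma sum_ReIm_mul x y :
  \sum_i ReIm (sigma i x) * ReIm (sigma i y) = \sum_i sigma i x * (sigma i y)^*.
Proof.
under eq_bigr do rewrite ReIm_mulE.
rewrite !big_split /= -!mulr_sumr -!mulr_suml.
rewrite [\sum_i (sigma i x * sigma i y)^*]sum_conj; last first.
  by move=> i; rewrite !sigma_conj rmorphM.
rewrite [\sum_i (sigma i x * _^* )^*]sum_conj; last first.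
  by move=> i; rewrite !sigma_conj rmorphM.
by rewrite mulNr addNr add0r -splitr.
Qed.

Definition coord_mx (w : m.-tuple L) : 'M[algR]_m :=
  \matrix_(i, j) coordR j (tnth w i).

Lemma det_coord_mx w :
  algRval (\det (coord_mx w)) ^+ 2 = `|\det (emb_mx sigma w)| ^+ 2.
Proof.
rewrite -det_map_mx normCK expr2 -[X in _ * X]det_tr -det_mulmx.
rewrite -[X in _ * X^*]det_tr -(det_map_mx (Num.conj : {rmorphism algC -> algC})).
rewrite -det_mulmx; congr (\det _); apply/matrixP => i j.
rewrite !mxE -[RHS]/(\sum_k _); transitivity (\sum_k ReIm (sigma k (tnth w i)) * ReIm (sigma k (tnth w j))).
  by apply: eq_bigr => k _; rewrite !mxE.
by rewrite sum_ReIm_mul; apply: eq_bigr => k _; rewrite !mxE.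
Qed.

Lemma det_coord_mx_sqr w :
  \det (coord_mx w) ^+ 2 = `|ratr (basis_discr w)|.
Proof.
apply: (fmorph_inj algRval); rewrite rmorphXn /= det_coord_mx.
rewrite -normrX -(ratr_discr sigma_a_inj).
by rewrite -(fmorph_rat algRval).
Qed.

(** The norm of a nonzero integral element is a nonzero rational integer. *)
Lemma prod_normR_ge1 x : integral x -> x != 0 -> 1 <= \prod_j normR j x.
Proof.
move=> xi x0; have /intrP[z zE] : \prod_j sigma j x \in Num.int.
  apply: Cint_rat_Aint; first exact: (prod_emb_rat sigma_a_inj).
  by apply: rpred_prod => j _; apply: Aint_emb.
have : algRval (\prod_j normR j x) = `|z%:~R|.
  by rewrite rmorph_prod -zE normr_prod.
rewrite -intr_norm => pE; have {}pE : \prod_j normR j x = `|z|%:~R.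
  by apply: (fmorph_inj algRval); rewrite rmorph_int.
rewrite pE -[1]/(1%:~R) ler_int -gtz0_ge1 normr_gt0; apply: contraNneq x0 => z0.
have : \prod_j sigma j x == 0 by rewrite zE z0.
by case/prodf_eq0 => j _; rewrite fmorph_eq0.
Qed.

(** The coordinate of index [i0] is the only one allowed to be large.  If another
    conjugate of [b] were equal to the one of index [i0], they would have the same
    coordinate, all coordinates would be at most 1/2, and the norm would be less
    than 1. *)
Lemma exists_small_generator (w : m.-tuple L) (D : nat) :
    (0 < D)%N -> integral_basis w -> `|basis_discr w| <= D%:R -> exists b : L,
  [/\ integral b, injective (fun i => sigma i b) &
    forall k, `|(\prod_j ('X - (sigma j b)%:P))`_k| <= (generator_height m * D)%:R].
Proof.
move=> D0 wP wD; have wb : basis_of {:L} w by case: wP.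
have m_gt0 : (0 < m)%N := adim_gt0 _.
pose i0 : 'I_m := Ordinal m_gt0.
have detA0 : \det (coord_mx w) != 0.
  have : \det (coord_mx w) ^+ 2 != 0.
    by rewrite det_coord_mx_sqr normr_eq0 fmorph_eq0 (basis_discr_neq0 sigma_a_inj).
  by rewrite expf_eq0.
(* With bounds 1/2 for the other coordinates, [Y] makes the product of all bounds
   larger than [(2 m) ^ m] times the determinant. *)
pose Q : algR := (4 * m%:R) ^+ m.
pose Y := Q * `|\det (coord_mx w)|.
have Q_ge1 : 1 <= Q.
  apply: exprn_ege1; have : 1 <= m%:R :> algR by rewrite ler1n.
  by move=> ?; lra.
have Y0 : 0 < Y by rewrite mulr_gt0 ?normr_gt0//; lra.
pose c j : algR := if j == i0 then Y else 2^-1.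
have c0 j : 0 < c j by rewrite /c; case: eqP => //; rewrite invr_gt0.
have [|x x0 xP] := minkowski_linear_forms m_gt0 c0 detA0.
  rewrite (bigD1 i0)//= /c eqxx (eq_bigr (fun=> 2^-1)); last first.
    by move=> j /negPf ->.
  rewrite prodr_const cardC1 card_ord /Y /Q mulrAC ltr_pM2r ?normr_gt0//.
  have -> : 4 * m%:R = 2 * (2 * m%:R) :> algR by ring.
  rewrite [(2 * (2 * _)) ^+ m]exprMn mulrAC ltr_pMl; last first.
    by rewrite exprn_gt0// mulr_gt0 ?ltr0n.
  rewrite -[in X in X * _](prednK m_gt0) exprS exprVn mulfK ?expf_neq0 ?pnatr_eq0//.
  by rewrite ltr1n.
pose b := \sum_i tnth w i *~ x 0 i.
have yb j : (map_mx intr x *m coord_mx w) 0 j = coordR j b.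
  apply: (fmorph_inj algRval); rewrite mxE rmorph_sum /= /ReIm !raddf_sum.
  rewrite -big_split /=; apply: eq_bigr => i _.
  rewrite !mxE -[LHS]/((algRval _%:~R) * _) rmorph_int raddfMz /= !raddfMz -mulrzDl mulrzl.
  by [].
have bi : integral b.
  by apply: integral_comb => i; apply: integral_basis_integral.
have b0 : b != 0.
  apply: contraNneq x0 => b0; apply/eqP/rowP => i; rewrite mxE.
  have /freeP/(_ (fun i => (x 0 i)%:~R)) := basis_free wb.
  move=> /(_ _ i) xi; apply/eqP; rewrite -(intr_eq0 rat); apply/eqP/xi.
  by rewrite -[RHS]b0; apply: eq_bigr => k _; rewrite scaler_int (tnth_nth 0).
have yb_lt j : coordR j b ^+ 2 <= c j ^+ 2.
  have := xP j; rewrite yb => /ltW H; rewrite -[leLHS]real_normK ?num_real//.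
  by rewrite ler_sqr ?nnegrE ?normr_ge0// ltW.
have y0 : coordR i0 b ^+ 2 <= Y ^+ 2 by have := yb_lt i0; rewrite /c eqxx.
have yj j : j != i0 -> coordR j b ^+ 2 <= 2^-2.
  by move=> /negPf jE; have := yb_lt j; rewrite /c jE exprVn.
have small_false : coordR i0 b ^+ 2 <= 2^-2 -> False.
  move=> yi0; have := prod_normR_ge1 bi b0; apply/negP; rewrite -ltNge.
  have {}yj j : coordR j b ^+ 2 <= 2^-2 by have [->|/yj] := eqVneq j i0.
  have N2 j : normR j b <= 2^-1.
    have := coord_normR j b; have := yj j; have := yj (s j); have := normR_ge0 j b.
    by move=> *; nra.
  apply: (@le_lt_trans _ _ (\prod_(j < m) 2^-1)).
    by apply: ler_prod => j _; rewrite normR_ge0 N2.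
  by rewrite prodr_const card_ord exprn_ilt1 ?invf_lt1 ?invr_ge0 ?ltr1n// -lt0n.
have sep j : j != i0 -> sigma i0 b - sigma j b != 0.
  move=> ji0; rewrite subr_eq0; apply/eqP => sE; apply: small_false.
  have -> : coordR i0 b = coordR j b by apply: val_inj; rewrite /= /ReIm sE.
  exact: yj.
exists b; split=> //.
  (* Only the conjugate [i0] is known to be distinct from the others.  But the
   derivative [q^`()] of the characteristic polynomial has rational coefficients,
   so if it does not vanish at one conjugate of [b], it vanishes at none. *)
  have [q qE] := prod_XsubC_emb_rat sigma_a_inj b.
  pose z := (map_poly (in_alg L) q^`()).[b].
  have zE j : sigma j z = \prod_(k | k != j) (sigma j b - sigma k b).
    rewrite -deriv_prod_XsubC -qE deriv_map /z -horner_map -map_poly_comp /=.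
    congr _.[_]; apply: eq_map_poly => t /=.
    by rewrite alg_num_field fmorph_rat.
  have z0 : z != 0.
    rewrite -(fmorph_eq0 (sigma i0)) zE; apply/prodf_neq0 => j; exact: sep.
  move=> i j; apply: contraPeq => ij.
  have : sigma i z != 0 by rewrite fmorph_eq0.
  rewrite zE => /prodf_neq0/(_ j); rewrite eq_sym subr_eq0 => /(_ ij) /eqP//.
move=> k; apply: le_trans (coef_prod_XsubC_bound _ _ _) _.
pose B : algR := Q ^+ 2 * D%:R.
have B1 : 1 <= B.
  have : 1 <= D%:R :> algR by rewrite ler1n.
  rewrite /B; nra.
have YB : Y ^+ 2 <= B.
  rewrite /Y /B exprMn -normrX det_coord_mx_sqr normr_id ler_pM2l; last first.
    by rewrite exprn_gt0//; lra.
  move: wD; rewrite -(ler_rat algR) ratr_norm ratr_nat//.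
(* Bounds for the squared moduli of the conjugates of [b]: the large coordinate
   enters the modulus at the indices [i0] and [s i0] only. *)
pose t j : algR := (if j == i0 then B else 1) * (if j == s i0 then B else 1).
have prodt : \prod_j t j = B ^+ 2.
  by rewrite big_split /= -!big_mkcond !big_pred1_eq.
have t1 j : 1 <= t j by rewrite /t; do 2!case: eqP => _; nra.
have ss j : s (s j) = j by apply: sigma_a_inj; rewrite !sigma_conj conjCK.
have Nt j : normR j b ^+ 2 <= t j.
  have Ni0 : normR i0 b ^+ 2 <= B.
    have := coord_normR i0 b; have [->|/yj] := eqVneq (s i0) i0; nra.
  have BB : B <= B * B by nra.
  rewrite /t; have [->|ji0] := eqVneq j i0; first by case: eqP => _; lra.
  have [->|jsi0] := eqVneq j (s i0); first by rewrite normR_conj mul1r.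
  have sji0 : s j != i0 by apply: contra jsi0 => /eqP <-; rewrite ss.
  by have := coord_normR j b; have := yj _ ji0; have := yj _ sji0; lra.
have : \prod_j (1 + normR j b) <= (generator_height m * D)%:R.
  have -> : (generator_height m * D)%:R = 2 ^+ m * B.
    by rewrite /B /Q /generator_height !(natrM, natrX) -exprM mulnC mulrA.
  rewrite -ler_sqr ?nnegrE; first last.
  - by rewrite mulr_ge0 ?exprn_ge0//; lra.
  - by apply: prodr_ge0 => j _; have := normR_ge0 j b; lra.
  rewrite -prodrXl exprMn -prodt -exprM mulnC exprM.
  have -> : (2 ^+ 2) ^+ m = \prod_(j < m) (2 ^+ 2) :> algR by rewrite prodr_const card_ord.
  rewrite -big_split /=; apply: ler_prod => j _; rewrite sqr_ge0 /=.
  have := Nt j; have := t1 j; have := normR_ge0 j b; nra.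
set P := \prod_j _; set N := _%:R => PN.
have {PN} : algRval P <= algRval N := PN.
rewrite rmorph_prod rmorph_nat; under eq_bigr do rewrite rmorphD rmorph1.
by [].
Qed.

End SmallGenerator.

(** * Conjugate embeddings of the field generated by a root *)

Lemma irreducible_dvd (f p : {poly rat}) (x : algC) :
  irreducible_poly f -> root (QtoC f) x -> root (QtoC p) x -> f %| p.
Proof.
move=> [_ f_irr] fx px.
have gx : root (QtoC (gcdp f p)) x by rewrite gcdp_map root_gcd fx px.
have : gcdp f p %= f.
  apply: f_irr (dvdp_gcdl _ _); apply/negP => /size_poly1P[c c0 gE].
  by move: gx; rewrite gE map_polyC rootC fmorph_eq0 (negPf c0).
by move/eqp_dvdl <-; apply: dvdp_gcdr.
Qed.

Lemma irreducible_separable (f : {poly rat}) : irreducible_poly f -> separable_poly f.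
Proof.
move=> [f1 f_irr]; rewrite unlock /coprimep.
apply: contraT => g1; have /eqp_dvdl gf := f_irr _ g1 (dvdp_gcdl _ _).
have := dvdp_gcdr f f^`(); rewrite gf => /dvdp_leq.
have f0 : f != 0 by rewrite -size_poly_gt0 ltnW.
rewrite leqNgt lt_size_deriv// => H; case: notF; apply: H; apply/eqP => df0.
have := coef_deriv f (size f).-2; rewrite df0 coef0 => /esym/eqP.
case: (size f) f1 (lead_coefE f) => [|[|k]]//= _ lfE.
by rewrite mulrn_eq0 -lfE lead_coef_eq0 (negPf f0).
Qed.

Section Construction.
Variables (L : fieldExtType rat) (phi : {rmorphism L -> algC}) (a : L).
Variable f : {poly rat}.
Hypothesis f_irr : irreducible_poly f.
Hypothesis f_root : root (QtoC f) (phi a).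
Hypothesis a_gen : <<1; a>>%VS = {:L}%VS.

Lemma horner_phi (q : {poly rat}) : phi (map_poly (in_alg L) q).[a] = (QtoC q).[phi a].
Proof.
rewrite -horner_map -map_poly_comp /=; congr _.[_]; apply: eq_map_poly => t /=.
by rewrite alg_num_field fmorph_rat.
Qed.

Lemma dim_generated : \dim {:L} = (size f).-1.
Proof.
rewrite -a_gen dim_Fadjoin dimv1 muln1 -[LHS]/(adjoin_degree 1 a).+1.-1.
rewrite -size_minPoly; congr _.-1.
have /polyOver1P[p pE] := minPolyOver 1%AS a.
have fp : f %| p.
  apply: irreducible_dvd f_irr f_root _; rewrite /root -horner_phi -pE.
  by rewrite minPolyxx rmorph0.
have pf : p %| f.
  rewrite -(dvdp_map (in_alg L)) -pE minPoly_dvdp//; first exact: alg_polyOver.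
  by apply/rootP/(fmorph_inj phi); rewrite horner_phi rmorph0; apply/rootP.
rewrite pE size_map_poly; apply/eqp_size; rewrite /eqp pf fp//.
Qed.

(** An element of [L] is a polynomial in [a]; evaluating the same polynomial at another
    root of [f] is well defined because [f] divides every rational polynomial
    vanishing at one of its roots. *)
Lemma exists_embeddings : exists (sigma : 'I_(\dim {:L}) -> {rmorphism L -> algC})
    (s : 'I_(\dim {:L}) -> 'I_(\dim {:L})),
  [/\ injective (fun i => sigma i a), forall i x, sigma (s i) x = (sigma i x)^* &
      forall i, root (QtoC f) (sigma i a)].
Proof.
have f0 : f != 0 by rewrite -size_poly_gt0; case: f_irr => /ltnW.
have [rs fE] := closed_field_poly_normal (QtoC f).
have lf0 : lead_coef (QtoC f) != 0 by rewrite lead_coef_eq0 map_poly_eq0.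
have rs_uniq : uniq rs.
  rewrite -separable_prod_XsubC.
  have := irreducible_separable f_irr; rewrite -(separable_map (ratr : {rmorphism rat -> algC})).
  rewrite /= fE; set c := lead_coef _ in lf0 *; move: (\prod_(_ <- _) _) => p.
  by rewrite !unlock derivZ coprimepZl ?coprimepZr.
have rs_size : size rs = \dim {:L}.
  by rewrite dim_generated -(size_map_poly (ratr : {rmorphism rat -> algC})) /= fE
    size_scale// size_prod_XsubC.
have rs_root x : (x \in rs) = root (QtoC f) x by rewrite fE rootZ// root_prod_XsubC.
pose al (i : 'I_(\dim {:L})) := rs`_i.
have al_root i : root (QtoC f) (al i) by rewrite -rs_root mem_nth ?rs_size.
have qP x : exists q : {poly rat}, x = (map_poly (in_alg L) q).[a].
  by apply/Fadjoin1_polyP; rewrite a_gen memvf.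
pose q x := sval (cid (qP x)); have qE x : x = (map_poly (in_alg L) (q x)).[a].
  by rewrite /q; case: cid.
pose sg i x := (QtoC (q x)).[al i].
have sgE i p x : x = (map_poly (in_alg L) p).[a] -> sg i x = (QtoC p).[al i].
  move=> xE; apply/eqP; rewrite -subr_eq0 /sg -hornerN -hornerD -rmorphB -/(root _ _).
  have : f %| q x - p.
    apply: irreducible_dvd f_irr f_root _; apply/rootP.
    by rewrite -horner_phi rmorphB hornerD hornerN -qE -xE subrr rmorph0.
  by move=> /dvdpP[r ->]; rewrite rmorphM rootM al_root orbT.
have sgB i : zmod_morphism (sg i).
  move=> x y; rewrite (sgE i (q x - q y)) ?rmorphB ?hornerD ?hornerN//=.
  by rewrite -!qE.
have sgM i : monoid_morphism (sg i).
  split; first by rewrite (sgE i 1) ?rmorph1 ?hornerC.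
  move=> x y; rewrite (sgE i (q x * q y)) ?rmorphM ?hornerM//=.
  by rewrite -!qE.
pose sigma i : {rmorphism L -> algC} := HB.pack (sg i)
  (GRing.isZmodMorphism.Build _ _ _ (sgB i))
  (GRing.isMonoidMorphism.Build _ _ _ (sgM i)).
have sigma_a i : sigma i a = al i.
  by rewrite [LHS](sgE i 'X) map_polyX hornerX.
have [s sE] : exists s : 'I_(\dim {:L}) -> 'I_(\dim {:L}), forall i, al (s i) = (al i)^*.
  apply: (fin_all_exists (P := fun i j => al j = (al i)^*)) => i.
  have : (al i)^* \in rs.
    rewrite rs_root; have := al_root i; rewrite /root => /eqP fi.
    have := congr1 Num.conj fi; rewrite -horner_map -map_poly_comp rmorph0 => fci.
    apply/eqP; rewrite -fci; congr _.[_]; apply: eq_map_poly => t /=.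
    by rewrite fmorph_rat.
  case/(nthP 0) => j; rewrite rs_size => jm <-.
  by exists (Ordinal jm).
exists sigma, s; split=> [i j||i]; last by rewrite sigma_a.
  rewrite !sigma_a /al => /eqP; rewrite nth_uniq ?rs_size// => /eqP.
  exact: val_inj.
move=> i x; rewrite /sigma /= /sg sE -horner_map -map_poly_comp; congr _.[_].
by apply: eq_map_poly => t /=; rewrite fmorph_rat.
Qed.

End Construction.

(** * Polynomials parametrized by a generator of small height *)

Lemma map_ratr_intr (p : {poly int}) : QtoC (ZtoQ p) = ZtoC p.
Proof. by rewrite -map_poly_comp; apply: eq_map_poly => z /=; rewrite ratr_int. Qed.

Lemma prod_XsubC_perm (rs ts : seq algC) : uniq ts ->
  \prod_(r <- rs) ('X - r%:P) = \prod_(r <- ts) ('X - r%:P) -> perm_eq rs ts.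
Proof.
move=> ts_uniq E; apply: uniq_perm => //.
  by rewrite -separable_prod_XsubC E separable_prod_XsubC.
by move=> x; rewrite -!root_prod_XsubC E.
Qed.

(** [f] is the characteristic polynomial of [h(b)] in the field generated by a root [b] of
    [g].  It is stated for every list of the roots of [g], so that polynomials
    [f] with the same [g] can be compared on a common enumeration; the second
    conjunct says that norms from that field are rational. *)
Definition parametrizes (g f : {poly int}) (h : {poly rat}) :=
  forall rs, ZtoC g = \prod_(r <- rs) ('X - r%:P) ->
    ZtoC f = \prod_(r <- rs) ('X - ((QtoC h).[r])%:P) /\
    forall p, \prod_(r <- rs) (QtoC p).[r] \in Crat.

(** [g] is the characteristic polynomial of a small generator [b] of the field of [f], and
    [h] expresses the root [a] of [f] on the basis of the powers of [b]. *)
Lemma exists_generating_poly n H D (f : {poly int}) : (0 < D)%N ->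
    I_ n H f -> `|Delta f| <= D%:Z ->
  exists g h, [/\ g \is monic, size g = n.+1,
    forall k, `|g`_k| <= (generator_height n * D)%:Z & parametrizes g f h].
Proof.
move=> D0 [f_monic f_size _ f_irr].
have : root (ZtoC f) (some_root f).
  rewrite /some_root; apply: (@xgetPex _ 0 [set z | root (ZtoC f) z]%classic).
  have [|x] := closed_rootP (ZtoC f) _; last by exists x.
  have : (1 < size (ZtoQ f))%N by case: f_irr.
  by rewrite !size_map_inj_poly ?rmorph0//; [case: size => [|[]] | apply: intr_inj..].
rewrite /Delta /adjoin_rat; case: num_field_exists => L [phi [[|a []] //= [<-] gen]] fa Ddelta.
have a_gen : <<1; a>>%VS = {:L}%VS by rewrite -adjoin_seq1.
have fa' : root (QtoC (ZtoQ f)) (phi a) by rewrite map_ratr_intr.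
have [sigma [s [sa_inj s_conj s_root]]] := exists_embeddings f_irr fa' a_gen.
have m_n : \dim {:L} = n.
  by rewrite (dim_generated f_irr fa' a_gen) size_map_inj_poly ?rmorph0 ?f_size//; apply: intr_inj.
have a_int : integralOver (intr : int -> L) a.
  exists f => //; rewrite -(fmorph_root phi) -map_poly_comp.
  by rewrite (eq_map_poly (g := intr))// => z /=; rewrite rmorph_int.
have : exists d, exists2 w : (\dim {:L}).-tuple L, integral_basis w & basis_discr w = d%:~R.
  have [w wP] := exists_integral_basis sa_inj a_int.
  have [d dE] := discr_int sa_inj (fun i => integral_basis_integral i wP).
  by exists d, w.
move=> /(@xgetPex _ 0 [set d : int | exists2 w : (\dim {:L}).-tuple L,
   integral_basis w & basis_discr w = d%:~R]%classic).
rewrite -/(field_discr L) /= => -[w wP wd].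
have wD : `|basis_discr w| <= D%:R.
  by rewrite wd -intr_norm -[D%:R]/((D%:Z)%:~R) ler_int.
have [b [b_int b_inj b_le]] := exists_small_generator sa_inj s_conj D0 wP wD.
have [q qE] := prod_XsubC_emb_rat sa_inj b.
set G := \prod_j _ in qE b_le.
have /floorpP[g gE] : G \is a polyOver Num.int.
  apply/polyOverP => k; apply: Cint_rat_Aint; first by rewrite -qE coef_map Crat_rat.
  suff /polyOverP : G \is a polyOver Aint by [].
  by apply: rpred_prod => j _; rewrite polyOverXsubC Aint_emb.
have powb : basis_of {:L} (powers b) by rewrite (emb_basis sa_inj) det_emb_powers.
pose h : {poly rat} := \poly_(k < \dim {:L}) (if insub k is Some i then coord (powers b) i a else 0).
have aE j : sigma j a = (QtoC h).[sigma j b].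
  have {1}-> : a = (map_poly (in_alg L) h).[b].
    rewrite [LHS](coord_basis powb (memvf a)).
    rewrite (@horner_coef_wide _ (\dim {:L})); last first.
      by rewrite size_map_poly size_poly.
    apply: eq_bigr => i _; rewrite coef_map coef_poly ltn_ord insubT //= => lti.
    rewrite (nth_map i) ?size_enum_ord// nth_ord_enum mulr_algl; congr (coord _ _ _ *: _).
    exact: val_inj.
  exact: horner_phi.
exists g, h; split.
- have G_monic : G \is monic by apply: monic_prod => j _; apply: monicXsubC.
  rewrite monicE -(eqr_int algC) -(lead_coef_map_inj (f := intr))//; last exact: intr_inj.
  by rewrite -gE (monicP G_monic).
- rewrite -(size_map_inj_poly (f := (intr : int -> algC)))//; last exact: intr_inj.
  by rewrite -gE size_prod_XsubC /index_enum -enumT size_enum_ord m_n.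
- move=> k; have := b_le k; rewrite gE coef_map /= -intr_norm m_n.
  by rewrite -[_%:R]/(_%:Z%:~R) ler_int.
move=> rs; rewrite -gE => GE.
have perm_rs : perm_eq rs [seq sigma j b | j <- index_enum 'I_(\dim {:L})].
  apply: prod_XsubC_perm; last by rewrite -GE big_map.
  by rewrite map_inj_uniq ?index_enum_uniq.
split=> [|p].
  rewrite (perm_big _ perm_rs) big_map /=.
  under eq_bigr do rewrite -aE.
  rewrite -(big_map (fun j => sigma j a) xpredT (fun x => 'X - x%:P)).
  rewrite [LHS](all_roots_prod_XsubC (rs := [seq sigma j a | j <- index_enum 'I_(\dim {:L})])).
  - by rewrite (monicP (monic_map _ f_monic)) scale1r.
  - rewrite size_map /index_enum -enumT size_enum_ord m_n.
    by rewrite size_map_inj_poly ?f_size//; apply: intr_inj.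
  - by apply/allP => x /mapP[j _ ->]; rewrite -map_ratr_intr.
  - by rewrite uniq_rootsE map_inj_uniq ?index_enum_uniq.
rewrite (perm_big _ perm_rs) big_map /=.
have -> : \prod_j (QtoC p).[sigma j b] = \prod_j sigma j (map_poly (in_alg L) p).[b].
  by apply: eq_bigr => j _; rewrite horner_phi.
exact: (prod_emb_rat sa_inj).
Qed.

(** * Mahler measure and separation by unit cells *)

Section Landau.
Variable C : numClosedFieldType.
Implicit Types (p q : {poly C}) (rs : seq C).

Definition sqnorm N p : C := \sum_(k < N) `|p`_k| ^+ 2.

(** Reflecting a root in the unit circle does not change the sum of the squared
    moduli of the coefficients: the differences of corresponding terms
    telescope. *)
Lemma sqnorm_reflect N q (a : C) : a != 0 -> (size q < N)%N ->
  sqnorm N (q * ('X - a%:P)) = sqnorm N (q * (- a^* *: ('X - (a^*^-1)%:P))).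
Proof.
move=> a0; case: N => // N qN.
pose e k : C := if k == 0%N then 0 else q`_k.-1.
have key k : `|(q * ('X - a%:P))`_k| ^+ 2 - `|(q * (- a^* *: ('X - (a^*^-1)%:P)))`_k| ^+ 2
    = (1 - `|a| ^+ 2) * (`|e k| ^+ 2 - `|q`_k| ^+ 2).
  have -> : (q * ('X - a%:P))`_k = e k - a * q`_k.
    by rewrite mulrBr coefB coefMX coefMC /e mulrC.
  have -> : (q * (- a^* *: ('X - (a^*^-1)%:P)))`_k = q`_k - a^* * e k.
    rewrite -scalerAr coefZ mulrBr coefB coefMX coefMC /e mulrBr.
    rewrite -/(e k); set b := a^*; have b0 : b != 0 by rewrite conjC_eq0.
    by field.
  by rewrite !normCK !rmorphB !rmorphM /= conjCK; ring.
apply/eqP; rewrite -subr_eq0 /sqnorm -sumrB; under eq_bigr do rewrite key.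
rewrite -mulr_sumr sumrB big_ord_recl [X in _ * (_ - X)]big_ord_recr /=.
rewrite /e eqxx normr0 expr0n add0r nth_default ?normr0 ?expr0n ?addr0//.
by rewrite subrr mulr0.
Qed.

(** The roots outside the unit disc are reflected one by one and absorbed into [q], and
    so are the roots inside it, without reflection.  Each reflection multiplies the
    leading coefficient by the modulus of the root, and in the end the leading
    coefficient is one of the terms of [sqnorm]. *)
Lemma landau_gen N q rs : (size q + size rs <= N)%N ->
  `|lead_coef q| ^+ 2 * \prod_(r <- rs) Num.max 1 `|r| ^+ 2
    <= sqnorm N (q * \prod_(r <- rs) ('X - r%:P)).
Proof.
elim: rs q => [|a rs IH] q /= qN.
  rewrite !big_nil !mulr1; have [->|q0] := eqVneq q 0.
    by rewrite lead_coef0 normr0 expr0n /sqnorm sumr_ge0// => i _; exact: exprn_ge0.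
  have qN' : ((size q).-1 < N)%N.
    by rewrite prednK ?size_poly_gt0//; apply: leq_trans qN; apply: leq_addr.
  by rewrite /sqnorm (bigD1 (Ordinal qN'))//= lead_coefE lerDl sumr_ge0// => i _; exact: exprn_ge0.
rewrite !big_cons; set P := \prod_(r <- rs) ('X - r%:P).
have [a1|a1] := real_leP (normr_real a) (real1 C).
  rewrite expr1n mul1r mulrA.
  have -> : lead_coef q = lead_coef (q * ('X - a%:P)).
    by rewrite lead_coefM lead_coefXsubC mulr1.
  apply: IH; have [->|q0] := eqVneq q 0.
    by rewrite mul0r size_poly0 (leq_trans _ qN)// addnS leqW// leq_addl.
  by rewrite size_mul ?polyXsubC_eq0// size_XsubC addn2 /= addSn -addnS.
have a0 : a != 0 by rewrite -normr_gt0 (lt_trans ltr01).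
have P0 : P != 0.
  by apply: monic_neq0; apply: monic_prod => r _; apply: monicXsubC.
have c0 : - a^* != 0 by rewrite oppr_eq0 conjC_eq0.
have [->|q0] := eqVneq q 0.
  by rewrite lead_coef0 normr0 expr0n /= !mul0r /sqnorm sumr_ge0// => i _; exact: exprn_ge0.
rewrite [q * _]mulrA [q * _ * P]mulrAC sqnorm_reflect//; last first.
  by rewrite size_mul// size_prod_XsubC addnS /= -addnS.
rewrite [q * P * _]mulrAC mulrA -exprMn -normrM.
have -> : `|lead_coef q * a| = `|lead_coef (q * (- a^* *: ('X - (a^*^-1)%:P)))|.
  by rewrite lead_coefM lead_coefZ lead_coefXsubC mulr1 !normrM normrN norm_conjC.
apply: IH.
by rewrite -scalerAr size_scale// size_mul ?polyXsubC_eq0// size_XsubC addn2 /= addSn -addnS.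
Qed.

Lemma landau N rs : (size rs < N)%N ->
  \prod_(r <- rs) Num.max 1 `|r| ^+ 2 <= sqnorm N (\prod_(r <- rs) ('X - r%:P)).
Proof.
move=> rsN; have := @landau_gen N 1 rs; rewrite lead_coef1 normr1 expr1n !mul1r.
by apply; rewrite size_poly1.
Qed.

End Landau.

(** [2 * `|z| ^+ 2] is the sum of the squares of [ReIm z] and [ReIm z^*]. *)
Lemma normr_lt1_of_ReIm z : `|ReIm z| < 1 -> `|ReIm z^*| < 1 -> `|z| < 1.
Proof.
have sq x : x \is Creal -> `|x| < 1 -> x ^+ 2 < 1.
  by move=> xr x1; rewrite -real_normK// expr_lt1.
move=> /(sq _ (ReIm_real _)) y1 /(sq _ (ReIm_real _)) y2.
rewrite -(@expr_lt1 _ 2)// -(@ltr_pM2l _ 2)// mulr1 -[X in _ < X]/(1 + 1).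
apply: le_lt_trans (ltrD y1 y2).
by rewrite /ReIm Re_conj Im_conj normC2_Re_Im le_eqVlt; apply/orP; left; apply/eqP; ring.
Qed.

Lemma ge1_max1 (C : numClosedFieldType) (r : C) : 1 <= Num.max 1 `|r|.
Proof. by have [r1|/ltW] := real_leP (normr_real r) (real1 C). Qed.

Lemma le_max1 (C : numClosedFieldType) (r : C) : `|r| <= Num.max 1 `|r|.
Proof. by have [r1|/ltW] := real_leP (normr_real r) (real1 C). Qed.

Lemma Mahler_measure_bound n H (f : {poly int}) rs : I_ n H f ->
  ZtoC f = \prod_(r <- rs) ('X - r%:P) ->
  \prod_(r <- rs) Num.max 1 `|r| <= (n.+1 * H)%:R.
Proof.
move=> [f_monic f_size f_coef f_irr] fE.
have rs_n : size rs = n.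
  apply: succn_inj; rewrite -f_size -(size_prod_XsubC rs id) -fE size_map_inj_poly//.
  exact: intr_inj.
have n0 : (0 < n)%N.
  by case: f_irr; rewrite size_map_inj_poly ?f_size//; apply: intr_inj.
have H0 : (0 < H)%N by rewrite -ltz_nat (le_lt_trans _ (f_coef 0%N n0)).
have M0 : 0 <= \prod_(r <- rs) Num.max 1 `|r|.
  by apply: prodr_ge0 => r _; apply: le_trans (ge1_max1 r).
rewrite -ler_sqr ?nnegrE ?ler0n// -prodrXl.
apply: le_trans (@landau _ n.+1 rs _) _; first by rewrite rs_n.
rewrite -fE /sqnorm.
apply: (@le_trans _ _ (\sum_(k < n.+1) (H%:R ^+ 2))).
  apply: ler_sum => k _; rewrite ler_sqr ?nnegrE ?ler0n//.
  rewrite coef_map /= -intr_norm -[H%:R]/(H%:Z%:~R) ler_int.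
  have := ltn_ord k; rewrite ltnS leq_eqVlt => /predU1P[->|kn]; last exact/ltW/f_coef.
  by move: f_monic; rewrite monicE lead_coefE f_size /= => /eqP ->; rewrite normr1.
rewrite sumr_const card_ord -natrX -mulrnA -natrX ler_nat expnMn mulnC leq_mul2r.
by rewrite expnS leq_pmulr ?orbT// expn_gt0.
Qed.

Lemma irreducible_common_root n H (f f' : {poly int}) (x : algC) :
  I_ n H f -> I_ n H f' -> root (ZtoC f) x -> root (ZtoC f') x -> f = f'.
Proof.
rewrite -!map_ratr_intr => -[fm _ _ fi] [fm' _ _ fi'] fx fx'.
apply: (map_inj_poly (f := intr : int -> rat)) => //; first exact: intr_inj.
apply/eqP; rewrite -eqp_monic ?monic_map//.
by apply/andP; split; apply: irreducible_dvd fx _ || apply: irreducible_dvd fx' _.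
Qed.

(** The product of the differences [d r] is the norm of an algebraic integer, and all its
    factors have modulus less than 1; hence some difference vanishes, and [f] and
    [f'] have a common root. *)
Lemma generated_eq n H (f f' g : {poly int}) h h' rs :
    I_ n H f -> I_ n H f' -> parametrizes g f h -> parametrizes g f' h' ->
    ZtoC g = \prod_(r <- rs) ('X - r%:P) ->
    {in rs, forall r, Num.floor (ReIm (QtoC h).[r]) = Num.floor (ReIm (QtoC h').[r])} ->
  f = f'.
Proof.
move=> fI f'I gf gf' gE same.
have [fE grat] := gf _ gE; have [f'E _] := gf' _ gE.
have root_h r : r \in rs -> root (ZtoC f) (QtoC h).[r].
  move=> rrs; rewrite fE -(big_map (fun r => (QtoC h).[r]) xpredT (fun x => 'X - x%:P)).
  by rewrite root_prod_XsubC map_f.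
have root_h' r : r \in rs -> root (ZtoC f') (QtoC h').[r].
  move=> rrs; rewrite f'E -(big_map (fun r => (QtoC h').[r]) xpredT (fun x => 'X - x%:P)).
  by rewrite root_prod_XsubC map_f.
have monic_Aint n' (p : {poly int}) x : I_ n' H p -> root (ZtoC p) x -> x \in Aint.
  move=> [pm _ _ _] px; apply: root_monic_Aint px _ _; first exact: monic_map.
  by apply/polyOverP => k; rewrite coef_map /=.
pose d r := (QtoC (h - h')).[r].
have dE r : d r = (QtoC h).[r] - (QtoC h').[r] by rewrite /d rmorphB hornerD hornerN.
suff [r rrs /eqP] : exists2 r, r \in rs & d r = 0.
  rewrite dE subr_eq0 => /eqP hr; apply: (irreducible_common_root fI f'I (root_h r rrs)).
  by rewrite hr root_h'.
have conj_rs r : r \in rs -> r^* \in rs.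
  rewrite -!root_prod_XsubC -gE /root => /eqP gr.
  have := congr1 Num.conj gr; rewrite -horner_map -map_poly_comp rmorph0 => gcr.
  apply/eqP; rewrite -gcr; congr _.[_]; apply: eq_map_poly => t /=.
  by rewrite rmorph_int.
have d_conj r : d r^* = (d r)^*.
  rewrite /d -horner_map -map_poly_comp /=; congr _.[_]; apply: eq_map_poly => t /=.
  by rewrite fmorph_rat.
have ReIm_lt1 r : r \in rs -> `|ReIm (d r)| < 1.
  move=> rrs; have -> : ReIm (d r) = ReIm (QtoC h).[r] - ReIm (QtoC h').[r].
    by rewrite dE /ReIm !raddfB /=; ring.
  have /andP[] := real_floor_itv (ReIm_real (QtoC h).[r]).
  have /andP[] := real_floor_itv (ReIm_real (QtoC h').[r]).
  rewrite same//; set u := ReIm _; set v := ReIm _; set c := Num.floor _.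
  rewrite intrD => cv vc cu uc.
  rewrite real_ltr_norml ?rpredB ?ReIm_real//; apply/andP; split.
    by rewrite ltrBrDr addrC ltrBlDr (lt_le_trans vc)// lerD2r.
  by rewrite ltrBlDr addrC (lt_le_trans uc)// lerD2r.
have d_lt1 r : r \in rs -> `|d r| < 1.
  move=> rrs; apply: normr_lt1_of_ReIm; rewrite ?ReIm_lt1//.
  by rewrite -d_conj ReIm_lt1 ?conj_rs.
have /intrP[z zE] : \prod_(r <- rs) d r \in Num.int.
  apply: Cint_rat_Aint; first exact: grat.
  rewrite big_seq; apply: rpred_prod => r rrs; rewrite dE rpredB//.
    exact: monic_Aint fI (root_h r rrs).
  exact: monic_Aint f'I (root_h' r rrs).
have : `|\prod_(r <- rs) d r| < 1.
  case: rs fE d_lt1 {grat root_h root_h' f'E gE same conj_rs zE ReIm_lt1 z} => [|r rs] fE d_lt1.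
    case: fI => _ _ _ [f1 _]; have := congr1 (size : {poly algC} -> nat) fE.
    rewrite big_nil size_poly1 size_map_inj_poly//; last exact: intr_inj.
    move=> fs; move: f1; rewrite size_map_inj_poly ?fs//; exact: intr_inj.
  rewrite big_cons normrM; apply: le_lt_trans (d_lt1 r (mem_head _ _)).
  rewrite ler_piMr// normr_prod big_seq prodr_ile1// => t trs.
  by rewrite normr_ge0 ltW// d_lt1// inE trs orbT.
rewrite zE -intr_norm -[1]/(1%:~R) ltr_int.
move=> z1; have z0 : z = 0 by lia.
move: zE; rewrite z0 => /eqP; rewrite prodf_seq_eq0 => /hasP[r rrs /eqP dr].
by exists r.
Qed.

Lemma normr_ReIm_le z : `|ReIm z| <= 2 * `|z|.
Proof.
rewrite -ler_sqr ?nnegrE ?mulr_ge0// real_normK ?ReIm_real// exprMn normC2_Re_Im.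
have Rr := Creal_Re z; have Ir := Creal_Im z.
have : 0 <= ('Re z - 'Im z) ^+ 2 by rewrite real_exprn_even_ge0// rpredB.
have : 0 <= 2 * ('Re z ^+ 2 + 'Im z ^+ 2).
  by rewrite mulr_ge0// addr_ge0// real_exprn_even_ge0.
move=> /addr_ge0 H /H; rewrite /ReIm -subr_ge0; congr (_ <= _); ring.
Qed.

Lemma floor_ReIm_le z : (maxn 1 `|Num.floor (ReIm z)|)%:R <= 3 * Num.max 1 `|z|.
Proof.
have m1 := ge1_max1 z; have mz := le_max1 z.
have m0 : 0 <= Num.max 1 `|z| by apply: le_trans m1.
case: (leqP 1 `|Num.floor (ReIm z)|) => _; last first.
  by apply: le_trans m1 _; rewrite ler_peMl// ler1n.
rewrite -[_%:R]/((`|Num.floor (ReIm z)|%N%:Z)%:~R) abszE intr_norm.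
have /andP[f1 f2] := real_floor_itv (ReIm_real z).
set c := _%:~R in f1 *; rewrite intrD -/c in f2.
have cr : c \is Creal by apply: realz.
have -> : c = ReIm z - (ReIm z - c) by ring.
apply: le_trans (ler_normB _ _) _.
have -> : 3 * Num.max 1 `|z| = 2 * Num.max 1 `|z| + Num.max 1 `|z| by ring.
apply: lerD; first by apply: le_trans (normr_ReIm_le z) _; rewrite ler_pM2l.
rewrite ger0_norm ?subr_ge0//; apply: le_trans m1.
by rewrite lerBlDl ltW.
Qed.

Lemma cells_bound n H f g h rs : I_ n H f -> parametrizes g f h ->
    ZtoC g = \prod_(r <- rs) ('X - r%:P) -> size rs = n ->
  (\prod_(r <- rs) maxn 1 `|Num.floor (ReIm (QtoC h).[r])| <= 3 ^ n * (n.+1 * H))%N.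
Proof.
move=> fI gf gE rs_n; have [fE _] := gf _ gE.
rewrite -(ler_nat algC) natr_prod.
apply: (@le_trans _ _ (\prod_(r <- rs) (3 * Num.max 1 `|(QtoC h).[r]|))).
  by apply: ler_prod => r _; rewrite ler0n floor_ReIm_le.
rewrite big_split /= big_const_seq count_predT iter_mulr_1 rs_n natrM natrX.
rewrite ler_pM2l ?exprn_gt0//.
rewrite -(big_map (fun r => (QtoC h).[r]) xpredT (fun z => Num.max 1 `|z|)).
by apply: Mahler_measure_bound fI _; rewrite big_map.
Qed.

(** * Counting *)

(** Comparison with the telescoping series of [1 / k - 1 / (k + 1)]. *)
Lemma sum_inv_sqr_le (X : nat) : \sum_(k < X.+1) (maxn 1 k)%:R ^- 2 <= 3 :> rat.
Proof.
suff : \sum_(k < X.+1) (maxn 1 k)%:R ^- 2 <= 3 - (maxn 1 X)%:R^-1 :> rat.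
  by move/le_trans; apply; rewrite gerBl invr_ge0.
elim: X => [|[_|X IH]].
- by rewrite big_ord1 (maxn_idPl _)// expr1n invr1; lra.
- by rewrite big_ord_recr big_ord1 /= !(maxn_idPl _)// expr1n invr1; lra.
rewrite big_ord_recr /=; apply: (le_trans (lerD IH (lexx _))).
rewrite !(maxn_idPr _)//.
have X0 : (0 : rat) < X.+1%:R by rewrite ltr0n.
rewrite -[X.+2%:R]natr1; set x : rat := X.+1%:R in X0 *.
rewrite -subr_ge0.
have -> : 3 - (x + 1)^-1 - (3 - x^-1 + (x + 1) ^- 2) = ((x + 1) ^+ 2 * x)^-1.
  by field; rewrite !gt_eqF//; lra.
by rewrite invr_ge0 mulr_ge0 ?sqr_ge0// ltW.
Qed.

(** Rankin's trick: each vector counted satisfies [1 <= X ^ 2 / \prod_i w_i ^ 2] with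
    [w_i = maxn 1 (c i).2], and the sum of this upper bound over all vectors factors
    into [n] convergent sums.  The exponent 2 is affordable and makes the sums
    bounded, so that no logarithm appears. *)
Lemma card_bounded_prod n X :
  (#|[set c : {ffun 'I_n -> bool * 'I_X.+1} | \prod_i maxn 1 (c i).2 <= X]|
     <= 6 ^ n * X ^ 2)%N.
Proof.
rewrite -(ler_nat rat) -sum1_card natr_sum.
pose w (c : bool * 'I_X.+1) : rat := (maxn 1 c.2)%:R ^- 2.
have w0 c : 0 <= w c by rewrite /w invr_ge0 exprn_ge0.
apply: (@le_trans _ _ (\sum_(c : {ffun 'I_n -> bool * 'I_X.+1}) X%:R ^+ 2 * \prod_i w (c i))).
  rewrite big_mkcond /=; apply: ler_sum => c _; rewrite inE; case: ifP => cX; last first.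
    by rewrite mulr_ge0 ?exprn_ge0// prodr_ge0.
  rewrite /w -(big_morph (fun x : rat => x ^- 2) (id1 := 1) (op1 := *%R) (id2 := 1) (op2 := *%R)); first last.
  - by rewrite expr1n invr1.
  - by move=> x y; rewrite exprMn invfM.
  rewrite -natr_prod -expr_div_n exprn_ege1// ler_pdivlMr ?mul1r ?ler_nat//.
  by rewrite ltr0n prodn_gt0// => i; rewrite leq_max.
rewrite -mulr_sumr -(bigA_distr_bigA (fun _ => w)) prodr_const card_ord.
rewrite natrM natrX mulrC natrX ler_wpM2r ?exprn_ge0// lerXn2r ?nnegrE ?sumr_ge0//.
rewrite -(pair_big xpredT xpredT (fun _ (k : 'I_X.+1) => (maxn 1 k)%:R ^- 2)) /=.
by rewrite big_bool /=; have := sum_inv_sqr_le X; lra.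
Qed.

(** For an infinite [A] the left-hand side is empty, so that upper bounds on
    cardinals can be proved with no finiteness argument. *)
Lemma mem_fset_set_sub (T : choiceType) (A : set T) x : (x \in fset_set A)%fset -> A x.
Proof.
have [fA|nfA] := pselect (finite_set A); last by rewrite /fset_set; case: pselect.
by rewrite in_fset_set// inE.
Qed.

Lemma sum_card_fibers (T : eqType) (U : finType) (I : eqType) (s : seq I) (F : I -> seq T)
    (k : T -> I) (Phi : T -> U) (A : {set U}) :
    uniq s -> (forall d, uniq (F d)) ->
    (forall d f, d \in s -> f \in F d -> k f = d /\ Phi f \in A) ->
    (forall f f', k f \in s -> k f' \in s -> f \in F (k f) -> f' \in F (k f') ->
       Phi f = Phi f' -> f = f') ->
  (\sum_(d <- s) size (F d) <= #|A|)%N.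
Proof.
move=> s_uniq F_uniq Fs Phi_inj.
pose u := flatten [seq F d | d <- s].
have u_mem f : f \in u -> k f \in s /\ f \in F (k f).
  by move=> /flatten_mapP[d ds fd]; have [-> _] := Fs _ _ ds fd.
have u_uniq : uniq u.
  rewrite /u; elim: s s_uniq {u u_mem Phi_inj} Fs => //= d s IH /andP[ds s_uniq] Fs.
  rewrite cat_uniq F_uniq IH//=; last by move=> d' f d's; apply: Fs; rewrite inE d's orbT.
  rewrite andbT; apply/hasPn => f /flatten_mapP[d' d's fd']; apply/negP => fd.
  have [kd _] := Fs _ _ (mem_head d s) fd.
  have [kd' _] := Fs d' f (mem_behead (s := d :: s) d's) fd'.
  by move: ds; rewrite -kd kd' d's.
have -> : (\sum_(d <- s) size (F d) = size [seq Phi f | f <- u])%N.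
  by rewrite size_map size_flatten sumnE /shape -map_comp big_map.
have mu : uniq [seq Phi f | f <- u].
  by rewrite map_inj_in_uniq// => f f' /u_mem[? ?] /u_mem[? ?]; apply: Phi_inj.
rewrite -(card_uniqP mu); apply/subset_leq_card/fintype.subsetP => x /mapP[f /flatten_mapP[d ds fd] ->].
by have [] := Fs _ _ ds fd.
Qed.

Lemma M_le_card n H D (U : finType) (A : {set U}) (Phi : {poly int} -> U) :
    (forall f, I_ n H f -> `|Delta f| <= D%:Z -> Phi f \in A) ->
    (forall f f', I_ n H f -> I_ n H f' -> `|Delta f| <= D%:Z -> `|Delta f'| <= D%:Z ->
       Phi f = Phi f' -> f = f') ->
  (M_ n H D <= #|A|)%N.
Proof.
move=> PhiA Phi_inj; rewrite /M_.
have fibre d f : (f \in fset_set (I_ n H `&` [set f | Delta f = d])%classic)%fset ->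
    I_ n H f /\ Delta f = d by move/mem_fset_set_sub => [].
case: finite_supportP => [_|S SD _ _]; first by rewrite big_nil.
have {}SD d : d \in (S : seq int) -> `|d| <= D%:Z by apply: SD.
apply: (sum_card_fibers (F := fun d => fset_set (I_ n H `&` [set f | Delta f = d])%classic)
  (k := Delta) (Phi := Phi)) => [|d|d f dS /fibre[fI fd]|f f' fS f'S /fibre[fI _] /fibre[f'I _]].
- exact: fset_uniq.
- exact: fset_uniq.
- by split=> //; apply: PhiA => //; rewrite fd SD.
- by apply: Phi_inj => //; apply: SD.
Qed.

Definition shift_ord B (z : int) : 'I_(B.*2.+1) := inord (absz (z + B%:Z)).

Lemma shift_ord_inj B z z' : `|z| <= B%:Z -> `|z'| <= B%:Z ->
  shift_ord B z = shift_ord B z' -> z = z'.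
Proof.
move=> zB z'B /(congr1 val); rewrite /= !inordK; lia.
Qed.

(** Codes an integer by its sign and absolute value, the form in which
    [card_bounded_prod] counts. *)
Definition sign_abs_ord X (z : int) : bool * 'I_X.+1 := (z < 0, inord `|z|%N).

Lemma sign_abs_ord_inj X z z' : (`|z| <= X)%N -> (`|z'| <= X)%N ->
  sign_abs_ord X z = sign_abs_ord X z' -> z = z'.
Proof.
move=> zB z'B []; move=> sE /(congr1 val); rewrite /= !inordK//; lia.
Qed.

Lemma monic_poly_inj n (f f' : {poly int}) :
    f \is monic -> f' \is monic -> size f = n.+1 -> size f' = n.+1 ->
    (forall i : 'I_n, f`_i = f'`_i) -> f = f'.
Proof.
move=> fm f'm fn f'n ff'; apply/polyP => k; have [kn|] := ltnP k n; first exact: (ff' (Ordinal kn)).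
rewrite leq_eqVlt => /predU1P[<-|nk]; last by rewrite !nth_default ?fn ?f'n.
by move: fm f'm; rewrite !monicE !lead_coefE fn f'n /= => /eqP -> /eqP ->.
Qed.

(** Every polynomial of the box is counted here, with a bound equal to 1 for [H = 1],
    where the exponent [o H] gives no room for a constant. *)
Lemma M_le_all n H D : (0 < H)%N -> (M_ n H D <= (H.-1.*2.+1) ^ n)%N.
Proof.
move=> H0; pose Phi (f : {poly int}) := [ffun i : 'I_n => shift_ord H.-1 f`_i].
apply: leq_trans (M_le_card (A := [set: _]) (Phi := Phi) _ _) _.
- by move=> f _ _; rewrite inE.
- move=> f f' [fm fn fH _] [f'm f'n f'H _] _ _ /ffunP ff'.
  apply: (monic_poly_inj fm f'm fn f'n) => i; have := ff' i; rewrite !ffunE.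
  have HP (z : int) : `|z| < H%:Z -> `|z| <= H.-1%:Z by lia.
  by apply: shift_ord_inj; apply: HP; [apply: fH | apply: f'H].
- by rewrite cardsT card_ffun !card_ord.
Qed.

(** A polynomial is coded by the coefficients of its [g] and by the integral parts of
    its roots, enumerated as values of [h] at the roots of [g]. *)
Lemma M_le_small_generators n H D : (0 < D)%N ->
  (M_ n H D <= (generator_height n * D).*2.+1 ^ n * (6 ^ n * (3 ^ n * (n.+1 * H)) ^ 2))%N.
Proof.
move=> D0; set B := (generator_height n * D)%N; set X := (3 ^ n * (n.+1 * H))%N.
pose gen f gh := [/\ gh.1 \is monic, size gh.1 = n.+1,
  forall k, `|(gh.1 : {poly int})`_k| <= B%:Z & parametrizes gh.1 f gh.2].
have [gh ghP] : exists gh, forall f, I_ n H f -> `|Delta f| <= D%:Z -> gen f (gh f).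
  have : forall f, exists p, I_ n H f -> `|Delta f| <= D%:Z -> gen f p.
    move=> f; have [[fI fD]|nf] := pselect (I_ n H f /\ `|Delta f| <= D%:Z).
      by have [g [h ?]] := exists_generating_poly D0 fI fD; exists (g, h).
    by exists (0, 0) => fI fD; case: nf.
  by move=> /choice[gh ghP]; exists gh => f; apply: ghP.
pose rs (g : {poly int}) := sval (closed_field_poly_normal (ZtoC g)).
have rsP g : g \is monic -> ZtoC g = \prod_(r <- rs g) ('X - r%:P).
  rewrite /rs; case: closed_field_poly_normal => r /= {1}-> gm.
  by rewrite lead_coef_map_inj ?(monicP gm) ?scale1r//; apply: intr_inj.
have rs_size g : g \is monic -> size g = n.+1 -> size (rs g) = n.
  move=> gm gn; apply: succn_inj; rewrite -gn -(size_prod_XsubC (rs g) id) -rsP//.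
  by rewrite size_map_inj_poly//; apply: intr_inj.
pose cell f k := Num.floor (ReIm (QtoC (gh f).2).[(rs (gh f).1)`_k]).
pose Phi f : {ffun 'I_n -> 'I_B.*2.+1} * {ffun 'I_n -> bool * 'I_X.+1} :=
  ([ffun i : 'I_n => shift_ord B (gh f).1`_i],
  [ffun i : 'I_n => sign_abs_ord X (cell f i)]).
pose cells := [set c : {ffun 'I_n -> bool * 'I_X.+1} | \prod_i maxn 1 (c i).2 <= X]%N.
have prod_cell f : I_ n H f -> `|Delta f| <= D%:Z ->
    (\prod_(i < n) maxn 1 `|cell f i| <= X)%N.
  move=> fI fD; have [gm gn _ gf] := ghP f fI fD.
  have := cells_bound fI gf (rsP _ gm) (rs_size _ gm gn).
  by rewrite (big_nth 0) rs_size// big_mkord.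
have cell_le f (i : 'I_n) : I_ n H f -> `|Delta f| <= D%:Z ->
    (`|cell f i| <= X)%N.
  move=> fI fD; apply: leq_trans (prod_cell f fI fD); rewrite (bigD1 i)//=.
  apply: leq_trans (leq_maxr 1 _) _; apply: leq_pmulr.
  by rewrite prodn_gt0// => j; rewrite leq_max.
apply: leq_trans (M_le_card (A := finset.setX finset.setT cells) (Phi := Phi) _ _) _.
- move=> f fI fD; rewrite !inE /=; apply: leq_trans (prod_cell f fI fD).
  apply: eq_leq; apply: eq_bigr => i _; rewrite ffunE /= inordK// ltnS.
  exact: cell_le.
- move=> f f' fI f'I fD f'D [] /ffunP Eg /ffunP Ec.
  have [gm gn gB gf] := ghP f fI fD; have [g'm g'n g'B gf'] := ghP f' f'I f'D.
  have gg' : (gh f).1 = (gh f').1.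
    apply: (monic_poly_inj gm g'm gn g'n) => i; have := Eg i; rewrite !ffunE.
    exact: shift_ord_inj.
  have g'E := rsP _ gm; move: gf'; rewrite -gg' => gf'.
  apply: (generated_eq fI f'I gf gf' g'E) => r /(nthP 0)[k kn <-].
  rewrite rs_size// in kn; have := Ec (Ordinal kn); rewrite !ffunE /= /cell -gg'.
  apply: sign_abs_ord_inj; first exact: (cell_le f (Ordinal kn)).
  by rewrite gg'; apply: (cell_le f' (Ordinal kn)).
- by rewrite cardsX leq_mul ?card_bounded_prod// cardsT card_ffun !card_ord.
Qed.

(** * Comparison of exponents and conclusion *)

From mathcomp Require Import all_classical all_reals all_analysis.
Import numFieldNormedType.Exports.
Unset Implicit Arguments.
Local Open Scope classical_set_scope.

(** If [D ^ (3 * n + 2) >= H ^ (2 * n)], the term [H ^ n] is small enough.  Otherwise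
    [D] is eliminated with the opposite inequality, and there remains a comparison
    of exponents of [H], equivalent to [0 <= 3 n^3 - 9 n^2 - 24 n - 12]; this
    polynomial is positive at 5 and negative at 4. *)
Lemma min_exponent_tradeoff (n D H : nat) : (5 <= n)%N -> (0 < D)%N -> (0 < H)%N ->
  (minn (D ^ n * H ^ 2) (H ^ n) ^ (3 * n + 3) <= D ^ (3 * n + 2) * H ^ (n * (3 * n + 1)))%N.
Proof.
move=> n5 D0 H0; have [HD|/ltnW DH] := leqP (H ^ (2 * n)) (D ^ (3 * n + 2)).
  apply: (@leq_trans ((H ^ n) ^ (3 * n + 3))).
    by rewrite leq_exp2r ?geq_minr// addn3.
  have -> : ((H ^ n) ^ (3 * n + 3) = H ^ (2 * n) * H ^ (n * (3 * n + 1)))%N.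
    by rewrite -expnM -expnD; congr (_ ^ _)%N; lia.
  by rewrite leq_mul2r HD orbT.
apply: (@leq_trans ((D ^ n * H ^ 2) ^ (3 * n + 3))).
  by rewrite leq_exp2r ?geq_minl// addn3.
pose e := (3 * n ^ 2 - 2)%N.
have n2 : (25 <= n ^ 2)%N by rewrite -[25%N]/(5 ^ 2)%N leq_exp2r.
have -> : ((D ^ n * H ^ 2) ^ (3 * n + 3) = D ^ (3 * n + 2) * (D ^ e * H ^ (6 * n + 6)))%N.
  rewrite expnMn -!expnM mulnA -expnD; congr (_ ^ _ * _ ^ _)%N; last by lia.
  by rewrite /e; lia.
rewrite leq_mul2l; apply/orP; right.
have e2 : (0 < 3 * n + 2)%N by rewrite addn2.
rewrite -(leq_exp2r _ _ e2).
apply: (@leq_trans (H ^ (2 * n * e + (6 * n + 6) * (3 * n + 2)))%N).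
  rewrite expnMn -!expnM expnD leq_mul//.
    rewrite [(e * _)%N]mulnC [(D ^ _)%N]expnM [(H ^ _)%N]expnM leq_exp2r//.
    by rewrite /e subn_gt0; apply: leq_trans (leq_mul (leqnn 3) n2).
rewrite -expnM leq_pexp2l//.
have [k kE] : exists k, n = (k + 5)%N by exists (n - 5)%N; rewrite subnK.
have -> : e = (3 * k ^ 2 + 30 * k + 73)%N.
  by rewrite /e kE; apply/eqP; rewrite -(eqn_add2r 2) subnK; [apply/eqP; ring | rewrite -kE; lia].
rewrite kE; apply: leq_trans (leq_addr (3 * k ^ 3 + 36 * k ^ 2 + 111 * k + 18)%N _) _.
by apply: eq_leq; ring.
Qed.

Lemma M_le_min n : (0 < n)%N -> exists2 C : nat, (0 < C)%N & forall H D, (0 < H)%N -> (0 < D)%N ->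
  (M_ n H D <= C * minn (D ^ n * H ^ 2) (H ^ n))%N.
Proof.
move=> n0; have [K KE] : exists K, generator_height n = K by eexists.
have K0 : (0 < K)%N by rewrite -KE muln_gt0 !expn_gt0 muln_gt0 n0.
pose C1 := ((3 * K) ^ n * (6 ^ n * (3 ^ n * n.+1) ^ 2))%N.
have C10 : (0 < C1)%N by rewrite /C1 !(muln_gt0, expn_gt0) K0.
exists (C1 * 2 ^ n)%N => [|H D H0 D0]; first by rewrite muln_gt0 C10 expn_gt0.
rewrite minnMr leq_min; apply/andP; split; last first.
  apply: leq_trans (M_le_all n D H0) _; rewrite -mulnA -expnMn.
  apply: (@leq_trans ((2 * H) ^ n)%N); last exact: leq_pmull.
  by rewrite leq_exp2r//; lia.
apply: leq_trans (M_le_small_generators n H D0) _; rewrite KE mulnAC.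
apply: (@leq_trans (C1 * (D ^ n * H ^ 2))%N); last by rewrite leq_pmulr// expn_gt0.
have -> : (C1 * (D ^ n * H ^ 2) = (3 * K * D) ^ n * (6 ^ n * (3 ^ n * (n.+1 * H)) ^ 2))%N.
  by rewrite /C1 !expnMn; ring.
rewrite leq_mul2r; apply/orP; right.
rewrite leq_exp2r//.
have : (0 < K * D)%N by rewrite muln_gt0 K0.
rewrite -mulnA; lia.
Qed.

Theorem theorem1p2 (R : realType) (n : nat) (hn : (5 <= n)%N) :
  exists o : nat -> R, o @ \oo --> (0 : R) /\
    forall H D : nat, (0 < H)%N -> (1 <= D)%N ->
      (M_ n H D)%:R <=
        D%:R `^ ((3 * n + 2)%:R / (3 * n + 3)%:R) *
        H%:R `^ ((n * (3 * n + 1))%:R / (3 * n + 3)%:R + o H) :> R.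
Proof.
have [C C0 MC] := M_le_min n (leq_trans (isT : 0 < 5)%N hn).
have C1 : 1 <= C%:R :> R by rewrite ler1n.
exists (fun H => ln C%:R / ln H%:R); split.
  have lnC : 0 <= ln (C%:R : R) by rewrite ln_ge0.
  apply/cvgrPdist_lt => e e0; near=> H.
  have H1 : expR (ln C%:R / e) < H%:R :> R.
    by near: H; apply: nbhs_infty_gtr.
  have H0 : 0 < H%:R :> R by apply: lt_trans H1; apply: expR_gt0.
  have lnH : ln C%:R / e < ln H%:R :> R.
    by rewrite -[ltLHS]expRK ltr_ln// posrE expR_gt0.
  have lnH0 : 0 < ln H%:R :> R by apply: le_lt_trans lnH; rewrite divr_ge0// ltW.
  rewrite sub0r normrN ger0_norm ?divr_ge0 ?(ltW lnH0)//.
  by rewrite ltr_pdivrMr// mulrC -ltr_pdivrMr.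
move=> H D H0 D0.
pose m := minn (D ^ n * H ^ 2) (H ^ n).
have H0' : 0 < H%:R :> R by rewrite ltr0n.
have N0 : (0 < 3 * n + 3)%N by rewrite addn3.
have mle : m%:R <= D%:R `^ ((3 * n + 2)%:R / (3 * n + 3)%:R) *
    H%:R `^ ((n * (3 * n + 1))%:R / (3 * n + 3)%:R) :> R.
  rewrite -(@ler_pXn2r _ (3 * n + 3)) ?nnegrE ?mulr_ge0 ?powR_ge0 ?ler0n//.
  rewrite exprMn -!powR_mulrn ?powR_ge0// -!powRrM !divfK ?pnatr_eq0 -?lt0n//.
  rewrite !powR_mulrn ?ler0n// -!natrX -natrM ler_nat.
  exact: min_exponent_tradeoff.
rewrite powRD; last by rewrite (gt_eqF H0') implybT.
have [H1|H1] := leqP H 1.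
  have {H1 H0'}HE : H = 1%N by apply/eqP; rewrite eqn_leq H1.
  rewrite HE !powR1 !mulr1; apply: (@le_trans _ _ 1).
    have := M_le_all n D (ltn0Sn 0); rewrite exp1n => ?.
    by rewrite lern1.
  set a := _ / _; have {1}-> : 1 = 1 `^ a :> R by rewrite powR1.
  by rewrite ge0_ler_powR ?nnegrE ?ler1n ?divr_ge0 ?ler01 ?ler0n.
have -> : H%:R `^ (ln C%:R / ln H%:R) = C%:R :> R.
  rewrite /powR (gt_eqF H0') divfK ?lnK ?posrE ?(lt_le_trans ltr01)//.
  by rewrite gt_eqF// ln_gt0// ltr1n.
rewrite mulrA [leRHS]mulrC; apply: le_trans (ler_wpM2l _ mle); rewrite ?ler0n//.
by rewrite -natrM ler_nat; apply: MC.
Unshelve. all: by end_near.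
Qed.
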